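(* Let $m:\mathbb R\to[0,\infty)$ be a measurable even function with $\int_{\mathbb R}\frac{m(u)}{u^2+1}\,du<\infty$. Let $\sigma,\mu$ be positive measures on $\mathbb R$ with $\int_{\mathbb R}\frac{d\sigma(u)}{u^2+1}<\infty$ and $\int_{\mathbb R}\frac{d\mu(u)}{u^2+1}<\infty$, such that the associated real Hilbert spaces $\mathcal H(\sigma)$ and $\mathcal H(\mu)$ are separable and infinite-dimensional, with orthonormal bases $(g_n)_{n\ge0}$ and $(h_n)_{n\ge0}$ respectively. Put $P_1=P_\sigma$, $P_2=P_\mu$, $Z_n=Q^\sigma_{g_n}$, $W_n=Q^\mu_{h_n}$, and for $t\in\mathbb R$ set $$B^{(1)}_t=\sum_{n=0}^\infty\left(\int_{\mathbb R}\frac{1-\cos tu}{u}\zeta_n(u)\sqrt{m(u)}\,du\right)Z_{2n},\qquad B^{(3)}_t=\sum_{n=0}^\infty\left(\int_{\mathbb R}\frac{\sin tu}{u}\zeta_n(u)\sqrt{m(u)}\,du\right)Z_{2n+1},$$ $$B^{(2)}_t=\sum_{n=0}^\infty\left(\int_{\mathbb R}\frac{1-\cos tu}{u}\zeta_n(u)\sqrt{m(u)}\,du\right)W_{2n},\qquad B^{(4)}_t=\sum_{n=0}^\infty\left(\int_{\mathbb R}\frac{\sin tu}{u}\zeta_n(u)\sqrt{m(u)}\,du\right)W_{2n+1},$$ where the series for $B^{(1)},B^{(3)}$ converge in $L^2(P_1)$ and those for $B^{(2)},B^{(4)}$ converge in $L^2(P_2)$. Then the $\mathbb H$-valued process $$B^m_p=\left(B^{(1)}_{\lambda_1}+B^{(3)}_{\lambda_1}\right)e_++\left(B^{(2)}_{\lambda_2}+B^{(4)}_{\lambda_2}\right)e_-,\qquad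 p=\lambda_1e_++\lambda_2e_-\in\mathbb H,$$ is centered Gaussian with covariance function $$E_{\mathbb H}(B^m_pB^m_q)=K_m(p,q)=\int_{\mathbb R}\frac{(1-\cos pu)(1-\cos qu)+(\sin pu)(\sin qu)}{u^2}\,m(u)\,du,\qquad p,q\in\mathbb H.$$
   Context: Hyperbolic numbers: $\mathbb H=\{a+bk: a,b\in\mathbb R\}$ with $k\notin\mathbb R$ commuting with the reals and $k^2=1$. Put $e_\pm=\frac{1\pm k}{2}$; then $e_\pm^2=e_\pm$, $e_+e_-=0$, $e_++e_-=1$, and each $p\in\mathbb H$ is uniquely $p=\lambda_1e_++\lambda_2e_-$ with $\lambda_1,\lambda_2\in\mathbb R$ (operations are componentwise). A function $f:\mathbb R\to\mathbb R$ is extended to $\mathbb H$ by $f(p)=f(\lambda_1)e_++f(\lambda_2)e_-$; this is the meaning of $\cos pu$ and $\sin pu$ for $u\in\mathbb R$. Integrals of $\mathbb H$-valued functions are taken componentwise. White noise measures: $\mathcal S_{\mathbb R}$ is the space of real-valued Schwartz functions on $\mathbb R$, $\mathcal S'_{\mathbb R}$ its dual, $\mathcal C$ the cylinder $\sigma$-algebra of $\mathcal S'_{\mathbb R}$, and $\widehat s(u)=\int_{\mathbb R}e^{-iut}s(t)\,dt$. For a positive measure $\sigma$ with $\int\frac{d\sigma(u)}{u^2+1}<\infty$, $P_\sigma$ is the unique probability measure on $(\mathcal S'_{\mathbb R},\mathcal C)$ (given by the Bochner–Minlos theorem) with $e^{-\frac12\int|\widehat s(u)|^2d\sigma(u)}=\int_{\mathcal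 S'_{\mathbb R}}e^{i\langle w,s\rangle}dP_\sigma(w)$ for $s\in\mathcal S_{\mathbb R}$. $\mathcal H(\sigma)$ is the real Hilbert space completion of $\mathcal S_{\mathbb R}$ (modulo null vectors) for the inner product $\mathrm{Re}\int_{\mathbb R}\overline{\widehat{s_1}}\,\widehat{s_2}\,d\sigma$. The map $s\mapsto Q^\sigma_s$, $Q^\sigma_s(w)=\langle w,s\rangle$, is isometric into $L^2(\mathcal S'_{\mathbb R},\mathcal C,P_\sigma)$, and $Q^\sigma$ also denotes its extension to an isometry on $\mathcal H(\sigma)$. Normalized Hermite functions: $\zeta_n(x)=\frac{(-1)^n}{\pi^{1/4}2^{n/2}(n!)^{1/2}}e^{x^2/2}\left(\frac{d}{dx}\right)^ne^{-x^2}$, $n=0,1,2,\dots$ (an orthonormal basis of $L^2(\mathbb R,dx)$). Hyperbolic processes: for probability measures $P_1,P_2$ on a measurable space, $P_{\mathbb H}=P_1e_++P_2e_-$ and $L^2(P_{\mathbb H})=L^2(P_1)e_+\oplus L^2(P_2)e_-$. For $X=X_1e_++X_2e_-$, $E_{\mathbb H}(X)=E_{P_1}(X_1)e_++E_{P_2}(X_2)e_-$, so the covariance function of $X(p)=X_1(p)e_++X_2(p)e_-$ is $E_{\mathbb H}(X(p)X(q))=E_{P_1}(X_1(p)X_1(q))e_++E_{P_2}(X_2(p)X_2(q))e_-$. The process is (centered) Gaussian if $X_1$ is a (centered) Gaussian process with respect to $P_1$ and $X_2$ is a (centered) Gaussian process with respect to $P_2$. *)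

(* Defs.v *)
From HB Require Import structures.
From mathcomp Require Import all_boot all_order all_algebra.
From mathcomp.real_closed Require Import complex.
From mathcomp Require Import all_classical all_reals all_analysis.

From mathcomp Require Import ring.

Set Implicit Arguments.
Unset Strict Implicit.
Unset Printing Implicit Defensive.

Import Order.TTheory GRing.Theory Num.Theory.
Import numFieldTopology.Exports numFieldNormedType.Exports.

Local Open Scope classical_set_scope.
Local Open Scope complex_scope.
Local Open Scope ring_scope.

Section Complex.
Context (R : realType).

(* exp (i t) *)
Definition expi (t : R) : R[i] := cos t +i* sin t.

Definition Cintegral d (T : measurableType d) (mu : {measure set T -> \bar R})
    (f : T -> R[i]) : R[i] :=
  (\int[mu]_x complex.Re (f x)) +i* (\int[mu]_x complex.Im (f x)).

End Complex.

Section Schwartz.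
Context (R : realType).

Definition is_schwartz (f : R -> R) : Prop :=
  (forall n x, derivable (derive1n n f) x 1) /\
  (forall k n, exists C : R, forall x, `|x ^+ k * derive1n n f x| <= C).

Definition schwartz_pred : {pred R -> R} := [pred f | `[< is_schwartz f >]].

Lemma derive1n_lin (a : R) (f g : R -> R) :
  (forall n x, derivable (derive1n n f) x 1) -> (forall n x, derivable (derive1n n g) x 1) ->
  forall n, derive1n n (a *: f + g) = a *: derive1n n f + derive1n n g.
Proof.
move=> df dg; elim=> [|n IH]; first by rewrite !derive1n0.
rewrite !derive1nS IH; apply/funext => x.
rewrite !derive1E deriveD; [|exact: derivableZ|by []].
by rewrite deriveZ//= !fctE !derive1E.
Qed.

Lemma schwartz_submod_closed : submod_closed schwartz_pred.
Proof.
split=> [|a f g /asboolP[df bf] /asboolP[dg bg]]; apply/asboolP.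
  have z n : derive1n n (0 : R -> R) = 0.
    elim: n => [//|n IH]; rewrite derive1nS IH; apply/funext => x.
    by rewrite (_ : 0 = cst 0 :> (R -> R))// derive1_cst.
  split=> [n x|k n]; first by rewrite z; exact: derivable_cst.
  by exists 0 => x; rewrite z mulr0 normr0.
split=> [n x|k n]; rewrite derive1n_lin//.
  by apply: derivableD; [exact: derivableZ|exact: dg].
have [C fC] := bf k n; have [D gD] := bg k n.
exists (`|a| * C + D) => x; rewrite !fctE mulrDr.
rewrite (le_trans (ler_normD _ _))// lerD//.
by rewrite mulrCA normrM ler_wpM2l.
Qed.

HB.instance Definition _ :=
  GRing.isSubmodClosed.Build _ _ schwartz_pred schwartz_submod_closed.

Record schwartz := Schwartz {
  schwartz_fun :> R -> R;
  _ : schwartz_fun \in schwartz_pred }.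

HB.instance Definition _ := [isSub for schwartz_fun].
HB.instance Definition _ := [Choice of schwartz by <:].
HB.instance Definition _ := [SubChoice_isSubLmodule of schwartz by <:].

(* The Schwartz topology is generated by the seminorms
   sup_x |x ^ k * s^(n) x|, i.e. it is the initial topology of s |-> x ^ k s^(n)
   into the functions R -> R with uniform convergence. *)
Definition schwartz_emb (s : schwartz) :
    prod_topology (fun _ : nat * nat => {uniform R -> R}) :=
  fun kn x => x ^+ kn.1 * derive1n kn.2 s x.

HB.instance Definition _ :=
  Topological.copy schwartz (initial_topology schwartz_emb).

Record tempered := Tempered {
  tempered_fun :> {scalar schwartz};
  tempered_continuous : continuous (tempered_fun : schwartz -> R) }.

Fact tempered0_continuous : continuous ((\0 : {scalar schwartz}) : schwartz -> R).
Proof. by move=> s; exact: (@cst_continuous (schwartz : topologicalType) R 0). Qed.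

HB.instance Definition _ := gen_eqMixin tempered.
HB.instance Definition _ := gen_choiceMixin tempered.
HB.instance Definition _ :=
  isPointed.Build tempered (Tempered tempered0_continuous).

Definition cylinders : set (set tempered) :=
  \bigcup_(s : schwartz)
    preimage_set_system setT (fun w : tempered => w s) measurable.

Definition tempered_space := g_sigma_algebraType cylinders.

End Schwartz.

Section WhiteNoise.
Context (R : realType).
Implicit Types sigma : {measure set (measurableTypeR R) -> \bar R}.

Definition fourier (s : schwartz R) (u : R) : R[i] :=
  Cintegral lebesgue_measure (fun t : R => expi (- (u * t)) * (s t)%:C).

Definition tempered_measure sigma : Prop :=
  (\int[sigma]_u ((u ^+ 2 + 1)^-1)%:E < +oo)%E.

Definition is_white_noise sigma (P : probability (tempered_space R) R) : Prop :=
  forall s : schwartz R,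
    (expR (- (2^-1 * \int[sigma]_u (complex.ComplexField.Normc.normc (fourier s u) ^+ 2))))%:C =
    Cintegral P (fun w : tempered R => expi (w s)).

Definition fourier_ip sigma (s1 s2 : schwartz R) : R :=
  complex.Re (Cintegral sigma (fun u => (fourier s1 u)^*%C * fourier s2 u)).

End WhiteNoise.

Section Hilbert.
Context (R : realType).

(* (H, ip, j) is the completion of the Schwartz space, modulo null vectors, for
   the inner product of sigma: j is the canonical map s |-> [s]. *)
Record is_completion (sigma : {measure set (measurableTypeR R) -> \bar R})
    (H : completeNormedModType R) (ip : {dot H for idfun})
    (j : {linear schwartz R -> H}) : Prop := IsCompletion {
  completion_norm : forall x : H, `|x| ^+ 2 = ip x x;
  completion_ip : forall s1 s2, ip (j s1) (j s2) = fourier_ip sigma s1 s2;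
  completion_dense : dense (range j) }.

Definition separable (T : topologicalType) : Prop :=
  exists D : set T, countable D /\ dense D.

Definition infinite_dimensional (V : lmodType R) : Prop :=
  forall n, exists v : 'I_n -> V,
    forall c : 'I_n -> R, \sum_(i < n) c i *: v i = 0 -> forall i, c i = 0.

Definition orthonormal_basis (H : completeNormedModType R)
    (ip : {dot H for idfun}) (e : nat -> H) : Prop :=
  (forall i k, ip (e i) (e k) = (i == k)%:R) /\
  dense [set x : H | exists n (c : nat -> R), x = \sum_(i < n) c i *: e i].

(* Elements of L^2(P) are represented by square-integrable random variables,
   equality in L^2(P) being almost sure equality. *)
Definition L2 d (T : measurableType d) (P : probability T R) :=
  LfunType P (lee1n 2).

Record is_noise_isometry (P : probability (tempered_space R) R)
    (H : completeNormedModType R) (j : {linear schwartz R -> H})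
    (Q : H -> L2 P) : Prop := IsNoiseIsometry {
  noise_linear : forall (a : R) (x y : H),
    Q (a *: x + y) = a *: Q x + Q y %[ae P];
  noise_isometry : forall x : H, 'N[P]_2%:E[EFin \o Q x]%E = `|x|%:E;
  noise_pairing : forall s : schwartz R,
    Q (j s) = (fun w : tempered R => w s) %[ae P] }.

(* X is the sum in L^2(P) of the series with general term c n *: Z n *)
Definition L2_sum d (T : measurableType d) (P : probability T R)
    (c : nat -> R) (Z : nat -> L2 P) (X : L2 P) : Prop :=
  ('N[P]_2%:E[EFin \o (fun w => (\sum_(0 <= n < N) c n * Z n w - X w)%R)]
    @[N --> \oo] --> 0)%E.

End Hilbert.

Section Hermite.
Context (R : realType).

Definition hermite_function (n : nat) (x : R) : R :=
  (-1) ^+ n / (pi `^ (1 / 4) * 2 `^ (n%:R / 2) * n`!%:R `^ (1 / 2)) *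
  expR (x ^+ 2 / 2) * derive1n n (fun y : R => expR (- y ^+ 2)) x.

Definition cos_coef (m : R -> R) (t : R) (n : nat) : R :=
  \int[lebesgue_measure]_u
    ((1 - cos (t * u)) / u * hermite_function n u * Num.sqrt (m u)).

Definition sin_coef (m : R -> R) (t : R) (n : nat) : R :=
  \int[lebesgue_measure]_u
    (sin (t * u) / u * hermite_function n u * Num.sqrt (m u)).

End Hermite.

Section Gaussian.
Context (R : realType) d (T : measurableType d) (P : probability T R).

(* Normal law with mean a and standard deviation s; the library's normal_prob
   is not the Dirac mass when s = 0. *)
Definition gaussian_law (a s : R) (A : set R) : \bar R :=
  if s == 0 then \d_a A else normal_prob a s A.

Definition gaussian_variable (X : T -> R) : Prop :=
  measurable_fun setT X /\
  exists a s : R, forall A : set R, measurable A ->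
    P (X @^-1` A) = gaussian_law a s A.

Definition gaussian_process (I : Type) (X : I -> T -> R) : Prop :=
  forall n (t : 'I_n -> I) (c : 'I_n -> R),
    gaussian_variable (fun w => \sum_(i < n) c i * X (t i) w).

Definition centered_gaussian_process (I : Type) (X : I -> T -> R) : Prop :=
  gaussian_process X /\ forall i, ('E_P[X i] = 0)%E.

End Gaussian.

(* Hyp a b is a + b k. *)
Record hyperbolic (R : Type) := Hyp { hre : R; him : R }.

Definition hyp_pair (R : Type) (p : hyperbolic R) : R * R := (hre p, him p).
Definition pair_hyp (R : Type) (x : R * R) : hyperbolic R := Hyp x.1 x.2.

Lemma hyp_pairK (R : Type) : cancel (@hyp_pair R) (@pair_hyp R).
Proof. by case. Qed.

HB.instance Definition _ (R : choiceType) :=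
  Choice.copy (hyperbolic R) (can_type (@hyp_pairK R)).

Section HyperbolicRing.
Context (R : realType).
Local Notation H := (hyperbolic R).
Implicit Types p q r : H.

Definition hyp_add p q : H := Hyp (hre p + hre q) (him p + him q).
Definition hyp_opp p : H := Hyp (- hre p) (- him p).
Definition hyp_mul p q : H :=
  Hyp (hre p * hre q + him p * him q) (hre p * him q + him p * hre q).
Definition hyp_scale (a : R) p : H := Hyp (a * hre p) (a * him p).

Lemma hyp_addA : associative hyp_add.
Proof. by move=> p q r; rewrite /hyp_add/= !addrA. Qed.
Lemma hyp_addC : commutative hyp_add.
Proof. by move=> p q; rewrite /hyp_add addrC [him _ + _]addrC. Qed.
Lemma hyp_add0 : left_id (Hyp 0 0) hyp_add.
Proof. by case=> a b; rewrite /hyp_add/= !add0r. Qed.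
Lemma hyp_addN : left_inverse (Hyp 0 0) hyp_opp hyp_add.
Proof. by case=> a b; rewrite /hyp_add/= !addNr. Qed.

HB.instance Definition _ :=
  GRing.isZmodule.Build H hyp_addA hyp_addC hyp_add0 hyp_addN.

Lemma hyp_mulA : associative hyp_mul.
Proof. by move=> [a b] [c d] [e f]; rewrite /hyp_mul/=; congr Hyp; ring. Qed.
Lemma hyp_mulC : commutative hyp_mul.
Proof. by move=> [a b] [c d]; rewrite /hyp_mul/=; congr Hyp; ring. Qed.
Lemma hyp_mul1 : left_id (Hyp 1 0) hyp_mul.
Proof. by move=> [a b]; rewrite /hyp_mul/=; congr Hyp; ring. Qed.
Lemma hyp_mulDl : left_distributive hyp_mul hyp_add.
Proof. by move=> [a b] [c d] [e f]; rewrite /hyp_mul/=; congr Hyp => /=; ring. Qed.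
Lemma hyp_1neq0 : Hyp 1 0 != 0 :> H.
Proof. by apply/eqP => -[] /eqP; rewrite oner_eq0. Qed.

HB.instance Definition _ := GRing.Zmodule_isComNzRing.Build H
  hyp_mulA hyp_mulC hyp_mul1 hyp_mulDl hyp_1neq0.

Lemma hyp_scaleA a b p : hyp_scale a (hyp_scale b p) = hyp_scale (a * b) p.
Proof. by rewrite /hyp_scale/= !mulrA. Qed.
Lemma hyp_scale1 : left_id 1 hyp_scale.
Proof. by case=> a b; rewrite /hyp_scale/= !mul1r. Qed.
Lemma hyp_scaleDr : right_distributive hyp_scale +%R.
Proof. by move=> a p q; rewrite /hyp_scale/= !mulrDr. Qed.
Lemma hyp_scaleDl p : {morph hyp_scale^~ p : a b / a + b}.
Proof. by move=> a b; rewrite /hyp_scale/= !mulrDl. Qed.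

HB.instance Definition _ := GRing.Zmodule_isLmodule.Build R H
  hyp_scaleA hyp_scale1 hyp_scaleDr hyp_scaleDl.

Definition hyp_k : H := Hyp 0 1.
Definition ep : H := 2^-1 *: (1 + hyp_k).
Definition em : H := 2^-1 *: (1 - hyp_k).

Definition lam1 p : R := hre p + him p.
Definition lam2 p : R := hre p - him p.

Lemma hyp_eq p q : hre p = hre q -> him p = him q -> p = q.
Proof. by case: p q => [a b] [c d] /= -> ->. Qed.

Lemma hyp_kk : hyp_k * hyp_k = 1.
Proof. by apply: hyp_eq => /=; ring. Qed.

Lemma hyp_decomp p : p = lam1 p *: ep + lam2 p *: em.
Proof. by apply: hyp_eq; rewrite /lam1 /lam2/=; field. Qed.

Lemma hyp_decomp_uniq p (a b : R) :
  p = a *: ep + b *: em -> a = lam1 p /\ b = lam2 p.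
Proof. by move=> ->; rewrite /lam1 /lam2/=; split; field. Qed.

Definition hyp_ext (f : R -> R) p : H := f (lam1 p) *: ep + f (lam2 p) *: em.

Definition hyp_integral d (T : measurableType d) (mu : {measure set T -> \bar R})
    (f : T -> H) : H :=
  (\int[mu]_x lam1 (f x)) *: ep + (\int[mu]_x lam2 (f x)) *: em.

End HyperbolicRing.

Section HyperbolicProcess.
Context (R : realType) d (T : measurableType d) (P1 P2 : probability T R).

(* E_H(X) for X in L^1(P1) ep + L^1(P2) em *)
Definition hyp_expectation (X : T -> hyperbolic R) : hyperbolic R :=
  fine ('E_P1[fun w => lam1 (X w)])%E *: ep R +
  fine ('E_P2[fun w => lam2 (X w)])%E *: em R.

Definition hyp_covariance (X : hyperbolic R -> T -> hyperbolic R)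
    (p q : hyperbolic R) : hyperbolic R :=
  hyp_expectation (fun w => X p w * X q w).

Definition hyp_centered_gaussian (X : hyperbolic R -> T -> hyperbolic R) : Prop :=
  centered_gaussian_process P1 (fun p w => lam1 (X p w)) /\
  centered_gaussian_process P2 (fun p w => lam2 (X p w)).

Definition hyp_process (B1 B3 : R -> L2 P1) (B2 B4 : R -> L2 P2)
    (p : hyperbolic R) (w : T) : hyperbolic R :=
  (B1 (lam1 p) w + B3 (lam1 p) w) *: ep R + (B2 (lam2 p) w + B4 (lam2 p) w) *: em R.

End HyperbolicProcess.

Definition hyp_kernel (R : realType) (m : R -> R) (p q : hyperbolic R) :
    hyperbolic R :=
  hyp_integral lebesgue_measure (fun u : R =>
    (m u / u ^+ 2) *:
      ((1 - hyp_ext cos (u *: p)) * (1 - hyp_ext cos (u *: q)) +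
       hyp_ext sin (u *: p) * hyp_ext sin (u *: q))).

(* Main.v *)
(* Both components are treated alike. For x in H(sigma), Q x is centered
   Gaussian of variance |x|^2: its characteristic function is the limit of those
   of the pairings <w, s>, for [s] tending to x. The series over the even and the
   odd indices are the images under the isometry Q of orthogonal elements of
   H(sigma), so their sums form a centered Gaussian process whose covariance is
   the sum over n of the products of the coefficients; these are the Hermite
   coefficients of (1 - cos tu)/u sqrt(m(u)) and sin tu/u sqrt(m(u)), and
   Parseval's identity turns the sum into the integral kernel.

   The completeness of the Hermite functions and the determination of a law by
   its characteristic function both come from one fact: bounded pointwise limits
   of trigonometric polynomials exhaust the bounded measurable functions. *)

Require Import Defs.
From HB Require Import structures.
From mathcomp Require Import all_boot all_order all_algebra.
From mathcomp Require Import all_classical all_reals all_analysis.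
From mathcomp Require Import measurable_realfun ring lra zify.
From mathcomp.real_closed Require Import complex.

Set Implicit Arguments.
Unset Strict Implicit.
Unset Printing Implicit Defensive.

Import Order.TTheory GRing.Theory Num.Theory.
Import numFieldTopology.Exports numFieldNormedType.Exports HBNNSimple.
Local Open Scope classical_set_scope.
Local Open Scope ring_scope.

(** Everything stays real: the characters e^{itx} are replaced by the cosines cos (t x + a) with a
    free phase a. This family contains the sines, and a product of two members is a half-sum of two
    members, so the closure under bounded limits is an algebra; it reaches the half-lines through
    polynomials in a sine, without any approximation theorem. Passing to such limits under an
    integral needs a majorant. A finite measure accepts a constant; for Lebesgue measure the factor
    e^{-x^2/2} provides one. Hence completeness is first obtained for h e^{-x^2/2} with h bounded,
    and a truncation then reaches all of L^2. Elements of L^2 are functions rather than classes, and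
    Q is linear only almost surely. The Hilbert space arguments are therefore made for semi-inner
    products, and the process is traded as early as possible for vectors of the completion, where
    linear combinations are exact: a combination of values of the process is almost surely Q of a
    single vector, which yields joint Gaussianity at once. The series converge because their
    coefficients are square-summable, by Bessel's inequality for the Hermite functions. *)

Lemma squeeze0 (R : realType) (u v : nat -> R) :
  (forall n, 0 <= u n <= v n) -> v n @[n --> \oo] --> 0 -> u n @[n --> \oo] --> 0.
Proof. by move=> uv v0; apply: (squeeze_cvgr _ (cvg_cst 0) v0); exact: nearW. Qed.

Lemma cvg_norm_le (R : realType) (u v : nat -> R) l :
  (forall n, `|u n - l| <= v n) -> v n @[n --> \oo] --> 0 -> u n @[n --> \oo] --> l.
Proof.
move=> uv v0; apply/cvgrPdist_lt => eps eps0.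
have /cvgrPdist_lt/(_ _ eps0) := v0; apply: filterS => n.
rewrite sub0r normrN distrC => vn.
by rewrite (le_lt_trans (uv n))// (le_lt_trans (ler_norm _)).
Qed.

Lemma cvg_sqr_le (R : realType) (u v : nat -> R) l :
  (forall n, (u n - l) ^+ 2 <= v n) -> v n @[n --> \oo] --> 0 -> u n @[n --> \oo] --> l.
Proof.
move=> uv v0; apply/cvgrPdist_lt => eps eps0.
have /cvgrPdist_lt/(_ _ (exprn_gt0 2 eps0)) := v0; apply: filterS => n.
rewrite sub0r normrN => vn; rewrite distrC -(ltr_pXn2r (ltn0Sn 1)) ?nnegrE ?(ltW eps0)//.
by rewrite real_normK ?num_real// (le_lt_trans (uv n))// (le_lt_trans (ler_norm _)).
Qed.

(** * Parseval's identity *)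

Section SemiInner.
Context (R : realType) (V : lmodType R).

(** Definiteness is left out so that one theory serves both the inner product of the completion and
    [L2_inner], which vanishes on functions that are zero almost everywhere. *)
Record semi_inner (b : V -> V -> R) : Prop := SemiInner {
  innerC : forall x y, b x y = b y x;
  inner_linear : forall a x y z, b (a *: x + y) z = a * b x z + b y z;
  inner_ge0 : forall x, 0 <= b x x }.

Variable b : V -> V -> R.
Hypothesis hb : semi_inner b.

Lemma innerDl x y z : b (x + y) z = b x z + b y z.
Proof. by rewrite -[x]scale1r (inner_linear hb) mul1r scale1r. Qed.

Lemma inner0l z : b 0 z = 0.
Proof. by have := innerDl 0 0 z; rewrite addr0 => /eqP; rewrite -subr_eq0 opprD addNKr oppr_eq0 => /eqP. Qed.

Lemma innerZl a x z : b (a *: x) z = a * b x z.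
Proof. by rewrite -[a *: x]addr0 (inner_linear hb) inner0l addr0. Qed.

Lemma innerNl x z : b (- x) z = - b x z.
Proof. by rewrite -scaleN1r innerZl mulN1r. Qed.

Lemma innerBl x y z : b (x - y) z = b x z - b y z.
Proof. by rewrite innerDl innerNl. Qed.

Lemma innerDr x y z : b z (x + y) = b z x + b z y.
Proof. by rewrite innerC// innerDl ![b z _]innerC. Qed.

Lemma innerZr a x z : b z (a *: x) = a * b z x.
Proof. by rewrite innerC// innerZl innerC. Qed.

Lemma innerBr x y z : b z (x - y) = b z x - b z y.
Proof. by rewrite innerC// innerBl ![b z _]innerC. Qed.

Lemma inner_suml n (F : 'I_n -> V) z : b (\sum_(i < n) F i) z = \sum_(i < n) b (F i) z.
Proof. by apply: (big_morph (b^~ z)) => [x y|]; [exact: innerDl|exact: inner0l]. Qed.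

Lemma inner_sqD x y : b (x + y) (x + y) = b x x + 2 * b x y + b y y.
Proof. by rewrite innerDl !innerDr (innerC hb y x); ring. Qed.

Lemma inner_sqB x y : b (x - y) (x - y) = b x x - 2 * b x y + b y y.
Proof. by rewrite innerBl !innerBr (innerC hb y x); ring. Qed.

Lemma inner_sqD_le x y : b (x + y) (x + y) <= 2 * b x x + 2 * b y y.
Proof. by have := inner_ge0 hb (x - y); rewrite inner_sqB inner_sqD; lra. Qed.

Lemma cauchy_schwarz x y : b x y ^+ 2 <= b x x * b y y.
Proof.
have H t : 0 <= b x x - 2 * t * b x y + t ^+ 2 * b y y.
  have -> : b x x - 2 * t * b x y + t ^+ 2 * b y y = b (x - t *: y) (x - t *: y).
    by rewrite inner_sqB !innerZr innerZl; ring.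
  exact: inner_ge0.
have [y0|] := eqVneq (b y y) 0.
  rewrite y0 mulr0; have [->|xy0] := eqVneq (b x y) 0; first by rewrite expr0n.
  (* With [b y y = 0] the polynomial in t is affine; at this t it would take the value -1. *)
  have := H ((b x x + 1) / (2 * b x y)); rewrite y0 mulr0 addr0 mulrA.
  suff -> : 2 * (b x x + 1) / (2 * b x y) * b x y = b x x + 1 by lra.
  by field.
move=> y0; have := inner_ge0 hb y; rewrite le_eqVlt eq_sym (negbTE y0)/= => {}y0.
(* The minimizer of the quadratic polynomial in t. *)
have := H (b x y / b y y); rewrite -(ler_pM2r y0) mul0r.
have -> : (b x x - 2 * (b x y / b y y) * b x y + (b x y / b y y) ^+ 2 * b y y) * b y y = b x x * b y y - b x y ^+ 2.
  by field; rewrite gt_eqF.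
by rewrite subr_ge0.
Qed.

Lemma inner_cvg (x : nat -> V) l z :
  b (x n - l) (x n - l) @[n --> \oo] --> 0 -> b (x n) z @[n --> \oo] --> b l z.
Proof.
move=> xl; apply: (@cvg_sqr_le _ _ (fun n => b (x n - l) (x n - l) * b z z)) => [n|].
  by rewrite -innerBl; exact: cauchy_schwarz.
by rewrite -(mul0r (b z z)); exact: cvgMr_tmp.
Qed.

Lemma inner_cvg2 (x y : nat -> V) l m :
  b (x n - l) (x n - l) @[n --> \oo] --> 0 ->
  b (y n - m) (y n - m) @[n --> \oo] --> 0 ->
  b (x n) (y n) @[n --> \oo] --> b l m.
Proof.
move=> xl ym.
(* The first term is a product of two errors, controlled by Cauchy-Schwarz; in the others one
   argument is fixed. *)
have E n : b (x n) (y n) = b (x n - l) (y n - m) + (b (x n) m + b (y n) l - b l m).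
  by rewrite innerBl !innerBr (innerC hb (y n) l); ring.
rewrite (funext E).
have H1 : b (x n - l) (y n - m) @[n --> \oo] --> 0.
  apply: (@cvg_sqr_le _ _ (fun n => b (x n - l) (x n - l) * b (y n - m) (y n - m))) => [n|].
    by rewrite subr0; exact: cauchy_schwarz.
  by rewrite -(mul0r 0); exact: cvgM.
have H2 : b (x n) m + b (y n) l - b l m @[n --> \oo] --> b l m + b m l - b l m.
  by apply: cvgB; [apply: cvgD; exact: inner_cvg|exact: cvg_cst].
move: H2; rewrite (innerC hb m l) addrK => H2.
suff H3 : b (x n - l) (y n - m) + (b (x n) m + b (y n) l - b l m) @[n --> \oo]
    --> 0 + b l m by rewrite add0r in H3.
exact: cvgD.
Qed.

Variable e : nat -> V.
Hypothesis he : forall i k, b (e i) (e k) = (i == k)%:R.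

Definition ortho_proj n x := \sum_(i < n) b x (e i) *: e i.

(** Stands for membership in the closed span of [e]: the property holds on [e], is stable under
    linear combinations and passes to limits. *)
Definition parseval_at x :=
  b (x - ortho_proj n x) (x - ortho_proj n x) @[n --> \oo] --> 0.

Lemma inner_orthonormal_sum n (c : nat -> R) k :
  b (\sum_(i < n) c i *: e i) (e k) = if (k < n)%N then c k else 0.
Proof.
rewrite inner_suml; case: ifPn => [kn|kn].
  rewrite (bigD1 (Ordinal kn))//= innerZl he eqxx mulr1 big1 ?addr0// => i.
  by rewrite innerZl he -val_eqE/= => /negbTE ->; rewrite mulr0.
rewrite big1// => i _; rewrite innerZl he.
by case: eqP => [ik|_]; [move: kn; rewrite -ik ltn_ord|rewrite mulr0].
Qed.

Lemma inner_orthonormal_sums n (c d : nat -> R) :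
  b (\sum_(i < n) c i *: e i) (\sum_(i < n) d i *: e i) = \sum_(i < n) c i * d i.
Proof.
rewrite inner_suml; apply: eq_bigr => i _.
by rewrite innerZl (innerC hb) inner_orthonormal_sum ltn_ord.
Qed.

Lemma inner_proj n x z : b (ortho_proj n x) z = \sum_(i < n) b x (e i) * b z (e i).
Proof.
rewrite /ortho_proj inner_suml; apply: eq_bigr => i _.
by rewrite innerZl (innerC hb z).
Qed.

Lemma inner_projs n x z : b (ortho_proj n x) (ortho_proj n z) = b (ortho_proj n x) z.
Proof. by rewrite (inner_proj n x z) (inner_orthonormal_sums n (fun i => b x (e i)) (fun i => b z (e i))). Qed.

Lemma inner_residual n x :
  b (x - ortho_proj n x) (x - ortho_proj n x) = b x x - \sum_(i < n) b x (e i) ^+ 2.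
Proof.
rewrite inner_sqB inner_projs (innerC hb x (ortho_proj n x)) inner_proj.
by under eq_bigr do rewrite -expr2; ring.
Qed.

Lemma inner_residual_le n x :
  b (x - ortho_proj n x) (x - ortho_proj n x) <= b x x.
Proof. by rewrite inner_residual gerBl sumr_ge0// => i _; rewrite sqr_ge0. Qed.

Lemma bessel n x : \sum_(i < n) b x (e i) ^+ 2 <= b x x.
Proof. by rewrite -subr_ge0 -inner_residual (inner_ge0 hb). Qed.

Lemma ortho_proj_linear n a x y :
  ortho_proj n (a *: x + y) = a *: ortho_proj n x + ortho_proj n y.
Proof.
rewrite /ortho_proj scaler_sumr -big_split/=; apply: eq_bigr => i _.
by rewrite (inner_linear hb) scalerDl scalerA.
Qed.

Lemma parseval_at_basis k : parseval_at (e k).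
Proof.
apply: (cvg_near_cst _ _ (F := \oo)).
near=> n; rewrite inner_residual he eqxx -(big_mkord xpredT (fun i => b (e k) (e i) ^+ 2)).
have kn : (k < n)%N by near: n; exists k.+1.
apply/eqP; rewrite subr_eq0 eq_sym; apply/eqP.
rewrite big_mkord (bigD1 (Ordinal kn))//= he eqxx expr1n big1 ?addr0// => i.
by rewrite he -val_eqE/= eq_sym => /negbTE ->; rewrite expr0n.
Unshelve. all: by end_near. Qed.

Lemma parseval_at_linear a x y :
  parseval_at x -> parseval_at y -> parseval_at (a *: x + y).
Proof.
move=> px py; rewrite /parseval_at.
have s0 : 2 * (a ^+ 2 * b (x - ortho_proj n x) (x - ortho_proj n x)) +
          2 * b (y - ortho_proj n y) (y - ortho_proj n y) @[n --> \oo] -->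
          2 * (a ^+ 2 * 0) + 2 * 0.
  by apply: cvgD; [apply: cvgMl_tmp|]; exact: cvgMl_tmp.
rewrite !mulr0 addr0 in s0.
apply: (squeeze0 _ s0) => n; rewrite (inner_ge0 hb)/=.
rewrite ortho_proj_linear opprD addrACA -scalerBr.
rewrite (le_trans (inner_sqD_le _ _))// innerZl innerZr; lra.
Qed.

(** The residual of x is at most twice that of x - y plus twice that of y. The first is bounded by
    [b (x - y) (x - y)] uniformly in n, so y can be fixed before n grows; the two contributions are
    below eps / 2 each, whence eps / 4. *)
Lemma parseval_at_closed x :
  (forall eps, 0 < eps -> exists2 y, parseval_at y & b (x - y) (x - y) < eps) ->
  parseval_at x.
Proof.
move=> H; apply/cvgrPdist_lt => eps eps0.
have [y py xy] := H (eps / 4) (divr_gt0 eps0 (ltr0n _ 4)).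
have e4 : 0 < eps / 4 by rewrite divr_gt0.
have /cvgrPdist_lt/(_ _ e4) := py; apply: filterS => n.
rewrite !sub0r !normrN !ger0_norm ?(inner_ge0 hb)// => yn.
have -> : x = 1 *: (x - y) + y by rewrite scale1r subrK.
rewrite ortho_proj_linear scale1r opprD addrACA scale1r.
apply: le_lt_trans (inner_sqD_le _ _) _.
have := inner_residual_le n (x - y); lra.
Qed.

Lemma parseval x z : parseval_at x ->
  \sum_(0 <= i < n) b x (e i) * b z (e i) @[n --> \oo] --> b x z.
Proof.
move=> px.
have E : (fun n => b (ortho_proj n x) z) = (fun n => \sum_(0 <= i < n) b x (e i) * b z (e i)).
  by apply/funext => n; rewrite big_mkord inner_proj.
rewrite -E; apply: inner_cvg.
by move: px; rewrite /parseval_at; under eq_fun do rewrite -opprB innerNl innerC// innerNl opprK.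
Qed.

End SemiInner.

(** * Bounded limits of trigonometric polynomials *)

Section TrigClosure.
Context (R : realType).

(* The closure of the trigonometric polynomials under bounded pointwise limits:
   by dominated convergence, a characteristic function determines the integrals
   of all its elements. *)
Inductive trig_closure : (R -> R) -> Prop :=
| trig_cos (t a : R) : trig_closure (fun x => cos (t * x + a))
| trig_linear (k : R) f g : trig_closure f -> trig_closure g ->
    trig_closure (fun x => k * f x + g x)
| trig_lim (f : nat -> R -> R) (g : R -> R) (M : R) :
    (forall n, trig_closure (f n)) -> (forall n x, `|f n x| <= M) ->
    (forall x, f n x @[n --> \oo] --> g x) -> trig_closure g.

Lemma eq_trig f g : f =1 g -> trig_closure f -> trig_closure g.
Proof. by move=> /funext ->. Qed.

Lemma trig_bounded f : trig_closure f -> exists M, forall x, `|f x| <= M.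
Proof.
elim=> [t a|k f0 g _ [M fM] _ [N gN]|f0 g M _ _ fM fg].
- by exists 1 => x; exact: cos_max.
- exists (`|k| * M + N) => x; rewrite (le_trans (ler_normD _ _))// normrM lerD//.
  by rewrite ler_wpM2l.
- exists M => x; have fgx : `|f0 n x| @[n --> \oo] --> `|g x| by exact: cvg_norm.
  rewrite -(cvg_lim _ fgx)//; apply: limr_le; first by apply/cvg_ex; exists `|g x|.
  exact: nearW.
Qed.

Lemma trig_cst k : trig_closure (fun=> k).
Proof.
have c1 : trig_closure (fun=> 1).
  by apply: (eq_trig _ (trig_cos 0 0)) => x; rewrite mul0r addr0 cos0.
have c0 : trig_closure (fun=> 0).
  by apply: (eq_trig _ (trig_linear (-1) c1 c1)) => x; ring.
by apply: (eq_trig _ (trig_linear k c1 c0)) => x; ring.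
Qed.

Lemma trigD f g : trig_closure f -> trig_closure g ->
  trig_closure (fun x => f x + g x).
Proof. by move=> cf cg; apply: (eq_trig _ (trig_linear 1 cf cg)) => x; ring. Qed.

Lemma trigZ k f : trig_closure f -> trig_closure (fun x => k * f x).
Proof. by move=> cf; apply: (eq_trig _ (trig_linear k cf (trig_cst 0))) => x; ring. Qed.

Lemma trigB f g : trig_closure f -> trig_closure g ->
  trig_closure (fun x => f x - g x).
Proof. by move=> cf cg; apply: (eq_trig _ (trig_linear (-1) cg cf)) => x; ring. Qed.

(** Induction on both closures. Two generators are handled by the product-to-sum formula, which the
    phases keep inside the family; a limit in one factor stays bounded because the other factor is
    bounded. *)
Lemma trigM f g : trig_closure f -> trig_closure g ->
  trig_closure (fun x => f x * g x).
Proof.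
move=> cf; elim: cf g => [t a|k f1 f2 _ IH1 _ IH2|f_ f1 M cf_ IH fM ff] g cg.
- elim: cg => [s b|k g1 g2 _ IH1 _ IH2|g_ g1 M cg_ IH gM gg].
  + have h := trigD (trig_cos (t + s) (a + b)) (trig_cos (t - s) (a - b)).
    apply: (eq_trig _ (trigZ 2^-1 h)) => x.
    rewrite (_ : (t + s) * x + (a + b) = (t * x + a) + (s * x + b)); last by ring.
    rewrite (_ : (t - s) * x + (a - b) = (t * x + a) - (s * x + b)); last by ring.
    by rewrite cosD cosB; field.
  + by apply: (eq_trig _ (trig_linear k IH1 IH2)) => x; ring.
  + apply: (trig_lim (M := M) IH) => [n x|x].
      by rewrite normrM -[M]mul1r ler_pM// cos_max.
    exact: cvgMl_tmp.
- by apply: (eq_trig _ (trig_linear k (IH1 _ cg) (IH2 _ cg))) => x; ring.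
- have [N gN] := trig_bounded cg.
  apply: (trig_lim (M := M * N) (fun n => IH n _ cg)) => [n x|x].
    by rewrite normrM ler_pM.
  exact: cvgMr_tmp.
Qed.

Lemma trigX f n : trig_closure f -> trig_closure (fun x => f x ^+ n).
Proof.
move=> cf; elim: n => [|n IH].
  by apply: (eq_trig _ (trig_cst 1)) => x; rewrite expr0.
by apply: (eq_trig _ (trigM cf IH)) => x; rewrite exprS.
Qed.

Lemma bernoulli_ineq (v : R) n : -1 <= v -> 1 + n%:R * v <= (1 + v) ^+ n.
Proof.
move=> v1; elim: n => [|n IH]; first by rewrite mul0r addr0 expr0.
rewrite exprS (le_trans _ (ler_wpM2l _ IH))//; last by lra.
rewrite -natr1; have : 0 <= n%:R * v ^+ 2 by rewrite mulr_ge0// sqr_ge0.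
lra.
Qed.

(** Write q = s^2. Since 1 - s^n = (1 - s)(1 + ... + s^(n-1)) is at least n s^n (1 - s), the
    sequence n s^n is bounded, and the remaining factor s^n tends to 0. *)
Lemma cvg_natM_geometric (q : R) : 0 <= q < 1 -> n%:R * q ^+ n @[n --> \oo] --> 0.
Proof.
move=> /andP[q0 q1]; pose s := Num.sqrt q.
have s0 : 0 <= s by exact: sqrtr_ge0.
have s1 : s < 1 by rewrite -sqrtr1 ltr_sqrt.
have H n : n%:R * s ^+ n * (1 - s) <= 1 - s ^+ n.
  elim: n => [|n IH]; first by rewrite !mul0r expr0 subrr.
  have sn : 0 <= s ^+ n by rewrite exprn_ge0.
  have := ler_wpM2l s0 IH; rewrite exprS -natr1; set t := s ^+ n in IH sn *; set k := n%:R.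
  have : s * t * (1 - s) <= 1 - s.
    rewrite -[leRHS]mul1r ler_wpM2r ?subr_ge0 ?(ltW s1)//.
    by rewrite mulr_ile1 ?(ltW s1)// /t exprn_ile1// ltW.
  lra.
have g0 : geometric (1 - s)^-1 s n @[n --> \oo] --> 0.
  by apply: cvg_geometric; rewrite ger0_norm.
apply: (squeeze0 _ g0) => n; rewrite mulr_ge0 ?exprn_ge0//=.
have sn : 0 <= s ^+ n by rewrite exprn_ge0.
have -> : n%:R * q ^+ n = (n%:R * s ^+ n) * s ^+ n.
  by rewrite -mulrA -exprMn -expr2 sqr_sqrtr.
rewrite ler_wpM2r// -[leRHS]mul1r ler_pdivlMr ?subr_gt0// (le_trans (H n))//.
by rewrite gerBl.
Qed.

(* As m 2^m u^m = m (2 u)^m, Bernoulli's inequality puts the threshold at 1/2. *)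
Lemma cvg_step (u : R) : 0 <= u <= 1 ->
  (1 - u ^+ m) ^+ (m * 2 ^ m) @[m --> \oo] --> ((u < 2^-1)%R%:R : R).
Proof.
move=> /andP[u0 u1].
have um m : 0 <= u ^+ m <= 1 by rewrite exprn_ge0//= exprn_ile1.
have E m : (m * 2 ^ m)%:R * u ^+ m = m%:R * (2 * u) ^+ m.
  by rewrite natrM natrX -mulrA -exprMn.
case: ltP => u2 /=.
  have q0 : m%:R * (2 * u) ^+ m @[m --> \oo] --> 0.
    by apply: cvg_natM_geometric; lra.
  apply: (cvg_norm_le _ q0) => m; have /andP[um0 um1] := um m.
  rewrite ler0_norm ?subr_le0 ?opprB ?exprn_ile1 ?subr_ge0 ?gerBl//.
  have h : -1 <= - u ^+ m by lra.
  by have := bernoulli_ineq (m * 2 ^ m) h; rewrite mulrN E; lra.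
(* This case includes u = 1/2, and the factor m in the exponent is there for it: with exponent 2^m
   alone the limit at 1/2 would be 1/e. *)
suff : (1 - u ^+ m) ^+ (m * 2 ^ m) @[m --> \oo] --> 0 by [].
apply: (squeeze0 _ (@cvg_harmonic R)) => m; have /andP[um0 um1] := um m.
rewrite exprn_ge0 ?subr_ge0//= /harmonic.
have h : -1 <= u ^+ m by lra.
have h1 : m.+1%:R <= (1 + u ^+ m) ^+ (m * 2 ^ m).
  apply: le_trans (bernoulli_ineq (m * 2 ^ m) h); rewrite E -natr1 addrC lerD2l.
  rewrite -[leLHS]mulr1 ler_wpM2l// exprn_ege1//; lra.
rewrite -[_^-1]mul1r ler_pdivlMr//.
(* As (1 - v)(1 + v) <= 1, the lower bound m + 1 on the power of 1 + v is an upper bound 1/(m + 1)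
   on the power of 1 - v. *)
apply: le_trans (_ : (1 - u ^+ m) ^+ (m * 2 ^ m) * (1 + u ^+ m) ^+ (m * 2 ^ m) <= 1).
  by rewrite ler_wpM2l// exprn_ge0// subr_ge0.
rewrite -exprMn exprn_ile1//; first by rewrite mulr_ge0; lra.
have : 0 <= (u ^+ m) ^+ 2 by rewrite sqr_ge0.
lra.
Qed.

(** The bound 2 stands in for pi, through [pi_ge2]. *)
Lemma sin_gt0_small (y : R) : `|y| < 2 -> (0 < sin y) = (0 < y).
Proof.
have p2 := @pi_ge2 R; rewrite ltr_norml => /andP[y1 y2].
case: (ltrgtP 0 y) => y0.
- by apply: sin_gt0_pi; rewrite y0; lra.
- apply/negbTE; rewrite -leNgt -[y]opprK sinN oppr_le0 ltW// sin_gt0_pi//; lra.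
- by rewrite -y0 sin0 ltxx.
Qed.

(* The half-line is the limit of {sin (t (x - a)) > 0} as t decreases to 0. *)
Lemma trig_gt (a : R) : trig_closure (fun x => (a < x)%R%:R).
Proof.
have step t : trig_closure (fun x => (0 < sin (t * (x - a)))%R%:R).
  (* An affine image of the sine with values in [0, 1], below 1/2 exactly where the sine is
     positive, so that [cvg_step] applies. *)
  pose u x : R := 2^-1 * (1 - sin (t * (x - a))).
  have cu : trig_closure u.
    apply: (trigZ 2^-1 (trigB (trig_cst 1) _)).
    apply: (eq_trig _ (trig_cos t (- (t * a) - pi / 2))) => x.
    by rewrite addrA cosBpihalf; congr sin; ring.
  have u01 x : 0 <= u x <= 1.
    by have := sin_le1 (t * (x - a)); have := sin_geN1 (t * (x - a)); rewrite /u; lra.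
  apply: (trig_lim (M := 1) (f := fun m x => (1 - u x ^+ m) ^+ (m * 2 ^ m))).
  - by move=> m; apply: trigX; apply: trigB; [exact: trig_cst|exact: trigX].
  - move=> m x; have /andP[u0 u1] := u01 x.
    by rewrite normrX exprn_ile1// ger0_norm ?gerBl ?subr_ge0 ?exprn_ge0// exprn_ile1.
  - move=> x; have -> : (0 < sin (t * (x - a))) = (u x < 2^-1).
      by apply/idP/idP; rewrite /u; lra.
    exact: cvg_step.
apply: (trig_lim (M := 1) (fun n => step n.+1%:R^-1)) => [n x|x].
  by rewrite normr_nat lern1 leq_b1.
apply: (cvg_near_cst _ _ (F := \oo)).
near=> n; rewrite sin_gt0_small.
  by rewrite pmulr_rgt0 ?invr_gt0// subr_gt0.
rewrite normrM gtr0_norm ?invr_gt0// mulrC ltr_pdivrMr//.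
have : `|x - a| < n%:R by near: n; exact: nbhs_infty_gtr.
by rewrite -(natr1 n) => ?; have := normr_ge0 (x - a); lra.
Unshelve. all: by end_near. Qed.

(** The sets whose indicator lies in the closure form a sigma-algebra: stability under products
    handles arbitrary unions, so no disjointness argument is needed. It contains the half-lines,
    which generate the Borel sets. *)
Lemma trig_indic (A : set R) : measurable A -> trig_closure \1_A.
Proof.
move=> mA; have {mA} : (@ocitv R).-sigma.-measurable A := mA.
rewrite RGenOInfty.measurableE; move: A.
pose S := [set B : set R | trig_closure \1_B].
change (<<s @RGenOInfty.G R >> `<=` S); apply: smallest_sub; last first.
  move=> _ [a ->]; apply: (eq_trig _ (trig_gt a)) => x.
  by rewrite indicE; congr (_%:R); rewrite mem_setE in_itv/= andbT.
split => [|B SB|F SF] /=.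
- by apply: (eq_trig _ (trig_cst 0)) => x; rewrite indic0.
- apply: (eq_trig _ (trigB (trig_cst 1) SB)) => x.
  by rewrite setTD !indicE in_setC; case: (_ \in _); rewrite ?subrr ?subr0.
(* The indicator of the union of the first n sets, written with products; at each point it is
   eventually constant. *)
pose p n x : R := 1 - \prod_(i < n) (1 - \1_(F i) x).
have cp n : trig_closure (p n).
  apply: trigB; first exact: trig_cst.
  elim: n => [|n IH].
    by apply: (eq_trig _ (trig_cst 1)) => x; rewrite big_ord0.
  apply: (eq_trig _ (trigM IH (trigB (trig_cst 1) (SF n)))) => x.
  by rewrite big_ord_recr.
have pE n x : p n x = (has (fun i => x \in F i) (iota 0 n))%:R.
  rewrite /p; elim: n => [|n IH]; first by rewrite big_ord0 subrr.
  rewrite -[n.+1]addn1 iotaD has_cat addn1 big_ord_recr/= orbF add0n.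
  move: IH; rewrite indicE.
  by case: has; case: (x \in F n) => /=; rewrite ?subrr ?subr0 ?mulr0 ?mulr1 ?subr0.
apply: (trig_lim (M := 1) cp) => [n x|x].
  by rewrite pE normr_nat lern1 leq_b1.
apply: (cvg_near_cst _ _ (F := \oo)).
have [/set_mem[i _ Fi]|xF] := boolP (x \in \bigcup_k F k).
  exists i.+1 => // n /= ni; rewrite pE indicE (mem_set (_ : (\bigcup_k F k) x)); last by exists i.
  suff -> : has (fun i => x \in F i) (iota 0 n) by [].
  by apply/hasP; exists i; [rewrite mem_iota|exact/mem_set].
apply: nearW => n; rewrite pE indicE (negbTE xF).
suff /negbTE -> : ~~ has (fun i => x \in F i) (iota 0 n) by [].
apply/hasP => -[i _ /set_mem Fi]; move/negP : xF; apply; apply/mem_set; by exists i.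
Qed.

Lemma trig_sum (I : Type) (s : seq I) (F : I -> R -> R) :
  (forall i, trig_closure (F i)) -> trig_closure (fun x => \sum_(i <- s) F i x).
Proof.
move=> cF; elim: s => [|i s IH].
  by apply: (eq_trig _ (trig_cst 0)) => x; rewrite big_nil.
by apply: (eq_trig _ (trigD (cF i) IH)) => x; rewrite big_cons.
Qed.

(** After adding M the function is nonnegative, hence a pointwise limit from below of simple
    functions, which are combinations of indicators and are bounded by 2M. *)
Theorem trig_closure_bounded (g : R -> R) (M : R) :
  measurable_fun setT g -> (forall x, `|g x| <= M) -> trig_closure g.
Proof.
move=> mg gM; pose f x := g x + M.
have f0 x : 0 <= f x by have := gM x; rewrite ler_norml /f; lra.
have f2 x : f x <= M + M by have := gM x; rewrite ler_norml /f; lra.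
suff cf : trig_closure f.
  by apply: (eq_trig _ (trigB cf (trig_cst M))) => x; rewrite /f addrK.
have mf : measurable_fun setT (EFin \o f).
  by apply/measurable_EFinP/measurable_funD.
pose h n : {nnsfun _ >-> R} := nnsfun_approx measurableT mf n.
have f0' x : setT x -> (0 <= (EFin \o f) x)%E by rewrite lee_fin.
have ch n : trig_closure (h n).
  have -> : (h n : R -> R) =
      fun x => \sum_(y <- finmap.enum_fset (fset_set (range (h n)))) y * \1_(h n @^-1` [set y]) x.
    by apply/funext => x; rewrite [LHS]fimfunE fsbig_finite.
  by apply: trig_sum => y; apply/trigZ/trig_indic.
have hf n x : h n x <= f x.
  by rewrite /h nnsfun_approxE -lee_fin; exact: le_approx.
apply: (trig_lim (M := M + M) ch) => [n x|x].
  by rewrite ger0_norm ?fun_ge0// (le_trans (hf n x)).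
have := cvg_nnsfun_approx measurableT mf f0' (I : setT x).
by move/fine_cvg.
Qed.

End TrigClosure.

(** * The space L^2 *)

Section L2Inner.
Context (R : realType) d (T : measurableType d) (mu : {measure set T -> \bar R}).
Notation L2m := (LfunType mu (lee1n 2)).
Implicit Types f g h : L2m.

Definition L2_inner f g : R := \int[mu]_x (f x * g x).

Lemma L2_measurable f : measurable_fun setT f.
Proof. exact: measurable_funPT. Qed.

Lemma L2M_integrable f g : mu.-integrable setT (EFin \o (fun x => f x * g x)).
Proof. by apply/Lfun1_integrable/Lfun2_mul_Lfun1; exact: LfunP. Qed.

Lemma semi_inner_L2 : semi_inner L2_inner.
Proof.
split=> [f g|a f g h|f].
- by apply: eq_Rintegral => x _; rewrite mulrC.
- rewrite /L2_inner -RintegralZl//; last exact: L2M_integrable.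
  rewrite -RintegralD//; [|exact: integrableZl (L2M_integrable _ _)|exact: L2M_integrable].
  by apply: eq_Rintegral => x _; rewrite mulrA -mulrDl.
- by apply: Rintegral_ge0 => x _; rewrite -expr2 sqr_ge0.
Qed.

Lemma Lnorm2E f : 'N[mu]_2%:E[EFin \o f]%E = (Num.sqrt (L2_inner f f))%:E.
Proof.
rewrite unlock (_ : (\int[mu]_x _ = (L2_inner f f)%:E)%E).
  by rewrite poweR_EFin -powR12_sqrt// (inner_ge0 semi_inner_L2).
rewrite /L2_inner /Rintegral fineK; last first.
  exact/integrable_fin_num/L2M_integrable.
apply: eq_integral => x _; by rewrite /= powR_mulrn// real_normK ?num_real// expr2.
Qed.

Lemma L2_inner_eq0 f : L2_inner f f = 0 -> f = (fun=> 0) %[ae mu].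
Proof.
move=> f0; have /Lnorm_eq0_eq0 : 'N[mu]_2%:E[EFin \o f]%E = 0%E.
  by rewrite Lnorm2E f0 sqrtr0.
have mf : measurable_fun setT (EFin \o f) by exact/measurable_EFinP/L2_measurable.
move=> /(_ mf (lte0n 2)); apply: filterS => x /(_ I) [] + _.
by [].
Qed.

Lemma Lfun2P (f : T -> R) : measurable_fun setT f ->
  mu.-integrable setT (EFin \o (fun x => f x ^+ 2)) -> f \in Lfun mu 2%:E.
Proof.
move=> mf /integrableP[_ fi]; rewrite inE; apply/andP; split; rewrite inE//=.
rewrite /finite_norm unlock poweR_lty//; apply: le_lt_trans fi.
rewrite le_eqVlt; apply/orP; left; apply/eqP; apply: eq_integral => x _ /=.
by rewrite powR_mulrn// normrX.
Qed.

Definition mkL2 (f : T -> R) (mf : measurable_fun setT f)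
  (fi : mu.-integrable setT (EFin \o (fun x => f x ^+ 2))) : L2m :=
  Lfun_Sub (lee1n 2) (Lfun2P mf fi).

Lemma L2_sqr_integrable f : mu.-integrable setT (EFin \o (fun x => f x ^+ 2)).
Proof. by under eq_fun do rewrite expr2; exact: L2M_integrable. Qed.

Lemma L2_inner_sqr f : L2_inner f f = \int[mu]_x (f x ^+ 2).
Proof. by apply: eq_Rintegral => x _; rewrite expr2. Qed.

Lemma L2_sumE n (F : 'I_n -> L2m) x : (\sum_(i < n) F i) x = \sum_(i < n) F i x.
Proof. by apply: (big_morph (fun f : L2m => f x)). Qed.

End L2Inner.

Lemma cvg_sqr0 (R : realType) (u : nat -> R) :
  u n @[n --> \oo] --> 0 -> u n ^+ 2 @[n --> \oo] --> 0.
Proof. by move=> h; rewrite -[0](mul0r (0 : R)); exact: cvgM. Qed.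

Lemma Rcvg_measurable (R : realType) d (T : measurableType d) (f_ : nat -> T -> R) (f : T -> R) :
  (forall n, measurable_fun setT (f_ n)) -> (forall x, f_ n x @[n --> \oo] --> f x) ->
  measurable_fun setT f.
Proof.
move=> mf_ f_f; apply/measurable_EFinP.
apply: (@emeasurable_fun_cvg _ _ _ _ (fun n => EFin \o f_ n)) => [n|x _].
  exact/measurable_EFinP.
by apply: cvg_EFin; [exact: nearW|exact: f_f].
Qed.

Section RDominated.
Context (R : realType) d (T : measurableType d) (mu : {measure set T -> \bar R}).
Variables (f_ : nat -> T -> R) (f g : T -> R).
Hypothesis mf_ : forall n, measurable_fun setT (f_ n).
Hypothesis f_f : forall x, f_ n x @[n --> \oo] --> f x.
Hypothesis ig : mu.-integrable setT (EFin \o g).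
Hypothesis f_g : forall n x, `|f_ n x| <= g x.

Let mf : measurable_fun setT f := Rcvg_measurable mf_ f_f.

Let dom : mu.-integrable setT (EFin \o f) /\
  (\int[mu]_x (f_ n x)%:E @[n --> \oo] --> \int[mu]_x (f x)%:E)%E.
Proof.
have mf1 n : measurable_fun setT (EFin \o f_ n) by exact/measurable_EFinP.
have mf2 : measurable_fun setT (EFin \o f) by exact/measurable_EFinP.
have [] // := dominated_convergence measurableT mf1 mf2 _ ig.
- by apply: aeW => x _; apply: cvg_EFin; [exact: nearW|exact: f_f].
- by apply: aeW => x n _ /=; rewrite lee_fin.
Qed.

Lemma Rdominated_cvg : \int[mu]_x f_ n x @[n --> \oo] --> \int[mu]_x f x.
Proof.
apply: fine_cvg; rewrite fineK; first exact: dom.2.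
exact: (integrable_fin_num _ dom.1).
Qed.

End RDominated.

(** * Gaussian integrals *)

Section GaussianWeight.
Context (R : realType).
Notation leb := (@lebesgue_measure R).

(** One family for several roles: c = 1 is the weight of the Hermite polynomials, c = 1/2 the factor
    of the Hermite functions, c = 1/(2 s^2) the normal density up to its constant, and a negative c
    serves as an integrating factor. *)
Definition gauss_weight (c x : R) : R := expR (- (c * x ^+ 2)).

Lemma gauss_weight_ge0 c x : 0 <= gauss_weight c x.
Proof. exact: expR_ge0. Qed.

Lemma gauss_weightD a b x : gauss_weight a x * gauss_weight b x = gauss_weight (a + b) x.
Proof. by rewrite /gauss_weight -expRD; congr expR; ring. Qed.

Lemma is_derive_gauss_weight c (x : R) :
  is_derive x 1 (gauss_weight c) (- (2 * c * x) * gauss_weight c x).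
Proof.
pose p : {poly R} := - (c *: 'X^2).
have pE y : p.[y] = - (c * y ^+ 2) by rewrite hornerN hornerZ hornerXn.
have -> : gauss_weight c = expR \o horner p by apply/funext => y /=; rewrite pE.
apply: (is_derive_eq (is_derive1_comp (is_derive_expR _) (is_derive_poly p x))).
by rewrite /= !pE derivN derivZ derivXn hornerN hornerZ hornerMn hornerXn expr1; ring.
Qed.

Lemma continuous_gauss_weight c : continuous (gauss_weight c).
Proof.
move=> x; apply/differentiable_continuous/derivable1_diffP.
by have [] := is_derive_gauss_weight c x.
Qed.

Lemma measurable_gauss_weight c : measurable_fun setT (gauss_weight c).
Proof. exact: continuous_measurable_fun (@continuous_gauss_weight c). Qed.

Lemma gauss_weight_integrable c : 0 < c -> leb.-integrable setT (EFin \o gauss_weight c).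
Proof.
(* The standard deviation whose centered normal density is proportional to e^{-c x^2}. *)
move=> c0; pose s := Num.sqrt ((2 * c)^-1).
have s0 : 0 < s by rewrite sqrtr_gt0 invr_gt0 mulr_gt0.
have -> : EFin \o gauss_weight c =
    (fun x => (normal_peak s)^-1%:E * (normal_pdf 0 s x)%:E)%E.
  apply/funext => x /=; rewrite normal_pdfE ?gt_eqF// -EFinM; congr EFin.
  rewrite mulKf ?gt_eqF ?normal_peak_gt0 ?gt_eqF//.
  rewrite /normal_fun subr0 sqr_sqrtr ?invr_ge0 ?mulr_ge0 ?ltW//.
  by rewrite -mulr_natr /gauss_weight; congr expR; field; rewrite gt_eqF.
by apply: integrableZl => //; exact: integrable_normal_pdf.
Qed.

Lemma gauss_dominated_integrable (f : R -> R) C c : 0 < c -> measurable_fun setT f ->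
  (forall x, `|f x| <= C * gauss_weight c x) -> leb.-integrable setT (EFin \o f).
Proof.
move=> c0 mf fC; apply: (@le_integrable _ _ _ leb _ measurableT _ (fun x => (C%:E * (gauss_weight c x)%:E)%E)).
- exact/measurable_EFinP.
- by move=> x _ /=; rewrite lee_fin (le_trans (fC x))// ler_norm.
- by apply: integrableZl => //; exact: gauss_weight_integrable.
Qed.

(** The power is at most 1 + (x^2)^(k+1), and the exponential series gives e^{c x^2} >= 1 + (c
    x^2)^(k+1) / (k+1)!. Comparing term by term yields the constant. *)
Lemma normX_le_gauss k (c : R) : 0 < c ->
  exists C, forall x : R, `|x| ^+ k * gauss_weight c x <= C.
Proof.
move=> c0; exists (1 + (k.+1)`!%:R / c ^+ k.+1) => x.
have p0 : 0 < gauss_weight c x by exact: expR_gt0.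
rewrite -ler_pdivlMr// /gauss_weight expRN invrK.
have h : `|x| ^+ k <= 1 + (x ^+ 2) ^+ k.+1.
  have [x1|x1] := leP `|x| 1.
    apply: le_trans (_ : 1 <= _); first by rewrite exprn_ile1.
    by rewrite lerDl exprn_ge0// sqr_ge0.
  rewrite -exprM -[x ^+ _]ger0_norm ?exprn_even_ge0 ?oddM// normrX.
  by rewrite (le_trans (ler_weXn2l (ltW x1) (_ : k <= 2 * k.+1)%N)) ?ler_wpDl//; lia.
apply: (le_trans h); rewrite mulrDl mul1r lerD//.
  by rewrite -[leLHS]expR0 ler_expR mulr_ge0 ?sqr_ge0// ltW.
rewrite -ler_pdivrMl ?divr_gt0 ?exprn_gt0 ?ltr0n ?fact_gt0// invf_div.
have := expR_ge1Dxn k (mulr_ge0 (ltW c0) (sqr_ge0 x)).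
apply: le_trans; rewrite -[leLHS]add0r lerD// [(c * _) ^+ _]exprMn.
by rewrite mulrAC.
Qed.

Lemma horner_le_gauss (p : {poly R}) (c : R) : 0 < c ->
  exists C, forall x, `|p.[x]| * gauss_weight c x <= C.
Proof.
move=> c0; rewrite -[p]coefK poly_def.
elim/big_ind : _ => [|p1 p2 [C1 h1] [C2 h2]|i _].
- by exists 0 => x; rewrite horner0 normr0 mul0r.
- exists (C1 + C2) => x; rewrite hornerD (le_trans _ (lerD (h1 x) (h2 x)))//.
  by rewrite -mulrDl ler_wpM2r ?gauss_weight_ge0// ler_normD.
- have [C h] := normX_le_gauss i c0; exists (`|p`_i| * C) => x.
  by rewrite hornerZ hornerXn normrM normrX -mulrA ler_wpM2l.
Qed.

(** Half of the exponent absorbs the polynomial, the other half remains as an integrable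
    majorant. *)
Lemma poly_gauss_integrable (p : {poly R}) c : 0 < c ->
  leb.-integrable setT (EFin \o (fun x => p.[x] * gauss_weight c x)).
Proof.
move=> c0; have c2 : 0 < c / 2 by rewrite divr_gt0.
have [C h] := horner_le_gauss p c2.
apply: (gauss_dominated_integrable (C := C) c2).
  by apply: measurable_funM; [exact: measurable_poly|exact: measurable_gauss_weight].
move=> x; rewrite (splitr c) -gauss_weightD -[c / 2 + c / 2]splitr.
rewrite mulrA !normrM !(ger0_norm (gauss_weight_ge0 _ _)).
by rewrite ler_wpM2r ?gauss_weight_ge0.
Qed.

Lemma cvg_gauss_weight c : 0 < c -> gauss_weight c n%:R @[n --> \oo] --> 0.
Proof.
move=> c0.
have [C h] := normX_le_gauss 1 c0.
have C0 : C * harmonic n @[n --> \oo] --> C * 0 by apply: cvgMl_tmp; exact: cvg_harmonic.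
rewrite mulr0 in C0; rewrite -(cvg_shiftS (fun n => gauss_weight c n%:R)).
apply: (squeeze0 _ C0) => n; rewrite gauss_weight_ge0/= ler_pdivlMr//.
by have := h n.+1%:R; rewrite expr1 normr_nat mulrC.
Qed.

(* The fundamental theorem of calculus on [-n, n], in the limit. *)
Lemma integral_derive_eq0 (F f : R -> R) :
  (forall x : R, is_derive x 1 F (f x)) -> continuous f ->
  leb.-integrable setT (EFin \o f) ->
  F n%:R @[n --> \oo] --> 0 -> F (- n%:R) @[n --> \oo] --> 0 ->
  \int[leb]_x f x = 0.
Proof.
move=> dF cf fi F0 F0'.
have cF : continuous F.
  by move=> x; apply/differentiable_continuous/derivable1_diffP; have [] := dF x.
pose f_ n x := f x * \1_(`[- n%:R, n%:R]%classic) x.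
have c1 : \int[leb]_x f_ n x @[n --> \oo] --> \int[leb]_x f x.
  apply: (@Rdominated_cvg _ _ _ leb f_ f (fun x => `|f x|)).
  - by move=> n; apply: measurable_funM => //; exact: continuous_measurable_fun.
  - move=> x; apply: (cvg_near_cst _ _ (F := \oo)); near=> n.
    rewrite /f_ indicE mem_set ?mulr1//= in_itv/= -ler_norml.
    by near: n; exact: nbhs_infty_ger.
  - exact: integrable_norm fi.
  - by move=> n x; rewrite normrM indicE ler_piMr// normr_nat lern1 leq_b1.
have d0 : F n%:R - F (- n%:R) @[n --> \oo] --> 0 - 0 by exact: cvgB.
have c2 : \int[leb]_x f_ n x @[n --> \oo] --> 0.
  (* The shift avoids n = 0, where [-n, n] is reduced to a point and the fundamental theorem does
     not apply. *)
  rewrite -(cvg_shiftS (fun n => \int[leb]_x f_ n x)).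
  have -> : (fun n => \int[leb]_x f_ n.+1 x) = (fun n => F n.+1%:R - F (- n.+1%:R)).
    apply/funext => n.
    transitivity (\int[leb]_(x in `[- n.+1%:R, n.+1%:R]) f x).
      rewrite [RHS]Rintegral_mkcond; apply: eq_Rintegral => x _.
      by rewrite patchE /f_ indicE; case: ifPn => _; rewrite ?mulr1 ?mulr0.
    rewrite /Rintegral (@continuous_FTC2 _ f F)//.
    - by rewrite (lt_trans (_ : _ < 0)) ?oppr_lt0 ?ltr0n.
    - exact: continuous_subspaceT.
    - split => [x _||].
        by have [] := dF x.
      - exact/cvg_at_right_filter/cF.
      - exact/cvg_at_left_filter/cF.
    - by move=> x _; rewrite derive1E; have [] := dF x.
  by rewrite (cvg_shiftS (fun n => F n%:R - F (- n%:R))); rewrite subrr in d0.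
by rewrite -(cvg_lim _ c1)// (cvg_lim _ c2).
Unshelve. all: by end_near. Qed.

Lemma measurable_cosL (t a : R) : measurable_fun setT (fun x : R => cos (t * x + a)).
Proof.
apply: (measurableT_comp (f := @cos R)); first exact: (continuous_measurable_fun (@continuous_cos R)).
by apply: measurable_funD => //; exact: measurable_funM.
Qed.

Lemma measurable_sinL (t a : R) : measurable_fun setT (fun x : R => sin (t * x + a)).
Proof.
apply: (measurableT_comp (f := @sin R)); first exact: (continuous_measurable_fun (@continuous_sin R)).
by apply: measurable_funD => //; exact: measurable_funM.
Qed.

Lemma is_derive_cosL (t a x : R) :
  is_derive x 1 (fun x => cos (t * x + a)) (- (t * sin (t * x + a))).
Proof.
pose p : {poly R} := t *: 'X + a%:P.
have pE y : p.[y] = t * y + a by rewrite hornerD hornerZ hornerX hornerC.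
have -> : (fun x => cos (t * x + a)) = cos \o horner p by apply/funext => y /=; rewrite pE.
apply: (is_derive_eq (is_derive1_comp (is_derive_cos _) (is_derive_poly p x))).
by rewrite pE derivD derivZ derivX derivC addr0 hornerZ hornerC; ring.
Qed.

Lemma is_derive_sinL (t a x : R) :
  is_derive x 1 (fun x => sin (t * x + a)) (t * cos (t * x + a)).
Proof.
pose p : {poly R} := t *: 'X + a%:P.
have pE y : p.[y] = t * y + a by rewrite hornerD hornerZ hornerX hornerC.
have -> : (fun x => sin (t * x + a)) = sin \o horner p by apply/funext => y /=; rewrite pE.
apply: (is_derive_eq (is_derive1_comp (is_derive_sin _) (is_derive_poly p x))).
by rewrite pE derivD derivZ derivX derivC addr0 hornerZ hornerC; ring.
Qed.

Lemma continuous_cosL (t a : R) : continuous (fun x : R => cos (t * x + a)).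
Proof.
move=> x; apply/differentiable_continuous/derivable1_diffP.
by have [] := is_derive_cosL t a x.
Qed.

Lemma continuous_sinL (t a : R) : continuous (fun x : R => sin (t * x + a)).
Proof.
move=> x; apply/differentiable_continuous/derivable1_diffP.
by have [] := is_derive_sinL t a x.
Qed.

Lemma cvg_bounded_gauss (f : R -> R) (c : R) : 0 < c -> (forall x, `|f x| <= 1) ->
  f n%:R * gauss_weight c n%:R @[n --> \oo] --> 0 /\
  f (- n%:R) * gauss_weight c (- n%:R) @[n --> \oo] --> 0.
Proof.
move=> c0 f1; split; apply: (cvg_norm_le _ (cvg_gauss_weight c0)) => n.
  by rewrite subr0 normrM (ger0_norm (gauss_weight_ge0 _ _)) ler_piMl ?gauss_weight_ge0.
have -> : gauss_weight c n%:R = gauss_weight c (- n%:R) by rewrite /gauss_weight sqrrN.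
by rewrite subr0 normrM (ger0_norm (gauss_weight_ge0 _ _)) ler_piMl ?gauss_weight_ge0.
Qed.

Section GaussCharacteristic.
Variables (c a : R).
Hypothesis c0 : 0 < c.

Let w := gauss_weight c.
Let k t := \int[leb]_x (cos (t * x + a) * w x).

Let cos_int t : leb.-integrable setT (EFin \o (fun x => cos (t * x + a) * w x)).
Proof.
apply: (gauss_dominated_integrable (C := 1) c0).
  by apply: measurable_funM; [exact: measurable_cosL|exact: measurable_gauss_weight].
by move=> x; rewrite normrM ler_pM// ?cos_max// ger0_norm// gauss_weight_ge0.
Qed.

Let xw_int : leb.-integrable setT (EFin \o (fun x => `|x| * w x)).
Proof.
have := integrable_norm (poly_gauss_integrable 'X c0).
apply: eq_integrable => // x _ /=.
by rewrite hornerX normrM (ger0_norm (gauss_weight_ge0 _ _)).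
Qed.

Let xsin_int t : leb.-integrable setT (EFin \o (fun x => x * sin (t * x + a) * w x)).
Proof.
apply: le_integrable xw_int => //.
  apply/measurable_EFinP; apply: measurable_funM; last exact: measurable_gauss_weight.
  by apply: measurable_funM => //; exact: measurable_sinL.
move=> x _ /=; rewrite lee_fin !normrM normr_id ler_wpM2r// ler_piMr//.
exact: sin_max.
Qed.

(** Integration by parts: the derivative of sin (t x + a) e^{-c x^2} has integral 0. *)
Let xsin_cos t : \int[leb]_x (x * sin (t * x + a) * w x) = t / (2 * c) * k t.
Proof.
have [F0 F0'] := cvg_bounded_gauss c0 (fun x => sin_max (t * x + a)).
have := @integral_derive_eq0 (fun x => sin (t * x + a) * w x)
  (fun x => t * (cos (t * x + a) * w x) - 2 * c * (x * sin (t * x + a) * w x)).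
rewrite RintegralB// ?RintegralZl//; last 2 first.
- exact: (integrableZl measurableT t (cos_int t)).
- exact: (integrableZl measurableT (2 * c) (xsin_int t)).
move=> h; have {h} /eqP : t * k t - 2 * c * \int[leb]_x (x * sin (t * x + a) * w x) = 0.
  apply: h => //.
  - move=> x; apply: (is_derive_eq (is_deriveM (is_derive_sinL t a x) (is_derive_gauss_weight c x))).
    by rewrite /GRing.scale/= -/w; ring.
  - move=> x; apply: cvgB; apply: cvgMl_tmp; apply: cvgM.
    + exact: continuous_cosL.
    + exact: continuous_gauss_weight.
    + by apply: cvgM; [exact: cvg_id|exact: continuous_sinL].
    + exact: continuous_gauss_weight.
  - rewrite /comp; under eq_fun do rewrite EFinB EFinM [X in (_ - X)%E]EFinM.
    apply: integrableB => //.
      exact: (integrableZl measurableT t (cos_int t)).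
    exact: (integrableZl measurableT (2 * c) (xsin_int t)).
by rewrite subr_eq0 => /eqP h; rewrite mulrAC h; field; rewrite gt_eqF.
Qed.

(** Differentiation under the integral sign, with the majorant |x| w(x), which does not depend on
    the parameter; [xsin_cos] then turns the derivative into the differential equation k' = - t k /
    (2c). *)
Let is_derive_k (t : R) : is_derive t (1 : R) k (- (t / (2 * c) * k t)).
Proof.
have It : `]t - 1, t + 1[%classic t by rewrite /= in_itv/=; lra.
pose f (s x : R) := cos (s * x + a) * w x.
have df (s x : R) : is_derive s (1 : R) (f ^~ x) (- (x * sin (s * x + a) * w x)).
  have h := is_derive_cosL x a s.
  have -> : f ^~ x = w x \*: (fun s => cos (x * s + a)).
    by apply/funext => y; rewrite /f mulrC [y * x]mulrC.
  by apply: (is_derive_eq (is_deriveZ _ h)); rewrite /GRing.scale/= [s * x]mulrC; ring.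
have d1 s x : partial1of2 f s x = - (x * sin (s * x + a) * w x).
  by rewrite partial1of2E; have [] := df s x.
have G x s : `|partial1of2 f s x| <= `|x| * w x.
  rewrite d1 normrN !normrM (ger0_norm (gauss_weight_ge0 _ _)).
  by rewrite ler_wpM2r ?gauss_weight_ge0// ler_piMr// sin_max.
have G0 x : 0 <= `|x| * w x by rewrite mulr_ge0// gauss_weight_ge0.
have h1 := @derivable_under_integral _ _ _ leb f _ measurableT t _ _ It
  (fun s _ => cos_int s) (fun s x _ _ => @ex_derive _ _ _ _ _ _ _ (df s x)) _ G0 xw_int (fun s x _ _ => G x s).
have h2 := @differentiation_under_integral _ _ _ leb f _ measurableT t _ _ It
  (fun s _ => cos_int s) (fun s x _ _ => @ex_derive _ _ _ _ _ _ _ (df s x)) _ G0 xw_int (fun s x _ _ => G x s).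
apply: DeriveDef; first exact: h1.
rewrite -derive1E h2 -xsin_cos.
under eq_Rintegral do rewrite d1 -mulN1r.
by rewrite RintegralZl// mulN1r.
Qed.

Lemma gauss_characteristic t :
  \int[leb]_x (cos (t * x + a) * w x) =
  cos a * expR (- (t ^+ 2 / (4 * c))) * \int[leb]_x w x.
Proof.
(* The integrating factor e^{t^2/(4c)} of this differential equation makes the product constant,
   hence equal to k(0). *)
pose u t := gauss_weight (- (4 * c)^-1) t * k t.
have du (s : R) : is_derive s (1 : R) u 0.
  apply: (is_derive_eq (is_deriveM (is_derive_gauss_weight _ s) (is_derive_k s))).
  by rewrite /GRing.scale/=; field; rewrite gt_eqF.
have := is_derive_0_is_cst t 0 du.
rewrite /u /k {2}/gauss_weight expr0n/= mulr0 oppr0 expR0 mul1r.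
under [in RHS]eq_Rintegral do rewrite mul0r add0r.
rewrite RintegralZl//; last exact: gauss_weight_integrable.
move=> h; rewrite mulrAC -h mulrAC /gauss_weight -expRD.
rewrite (_ : - (- (4 * c)^-1 * t ^+ 2) + - (t ^+ 2 / (4 * c)) = 0) ?expR0 ?mul1r//.
by ring.
Qed.

End GaussCharacteristic.
End GaussianWeight.

(** * Hermite functions *)

Section HermitePoly.
Context (R : realType).
Notation leb := (@lebesgue_measure R).
Implicit Types p q : {poly R}.

Lemma gauss_weight_half x : gauss_weight 2^-1 x * gauss_weight 2^-1 x = gauss_weight 1 x :> R.
Proof. by rewrite gauss_weightD -[2^-1]div1r -splitr. Qed.

(** As a linear functional on polynomials, integration against e^{-x^2} is always defined, and the
    orthogonality relations become algebra. *)
Definition gauss_int p : R := \int[leb]_x (p.[x] * gauss_weight 1 x).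

Let gi p := poly_gauss_integrable p (@ltr01 R).

Lemma gauss_int_linear a p q : gauss_int (a *: p + q) = a * gauss_int p + gauss_int q.
Proof.
rewrite /gauss_int -RintegralZl// -RintegralD//; last exact: (integrableZl measurableT a (gi p)).
by apply: eq_Rintegral => x _; rewrite hornerD hornerZ mulrDl mulrA.
Qed.

Lemma gauss_int0 : gauss_int 0 = 0.
Proof.
by have := gauss_int_linear (-1) 0 0; rewrite scaler0 addr0 mulN1r addNr.
Qed.

Lemma gauss_intZ a p : gauss_int (a *: p) = a * gauss_int p.
Proof. by rewrite -[a *: p]addr0 gauss_int_linear gauss_int0 addr0. Qed.

Lemma gauss_int1 : gauss_int 1 = Num.sqrt pi.
Proof.
rewrite /gauss_int /Rintegral.
under eq_integral do rewrite hornerE mul1r /gauss_weight mul1r.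
by rewrite integralT_gauss.
Qed.

(** The physicists' Hermite polynomials, given by the recurrence that differentiating H_n e^{-x^2}
    produces. *)
Fixpoint hermite_poly n : {poly R} :=
  if n is k.+1 then (2 *: 'X) * hermite_poly k - (hermite_poly k)^`() else 1.

Lemma hermite_polyS n :
  hermite_poly n.+1 = (2 *: 'X) * hermite_poly n - (hermite_poly n)^`().
Proof. by []. Qed.

Lemma deriv_hermite_poly n :
  (hermite_poly n.+1)^`() = (n.+1 * 2)%:R *: hermite_poly n.
Proof.
elim: n => [|n IH].
  by rewrite hermite_polyS /= mulr1 derivB derivZ derivX derivC linear0 subr0.
rewrite hermite_polyS derivB derivM IH derivZ derivX derivZ.
rewrite mulr_algl -scalerAr -addrA -scalerBr -hermite_polyS -scalerDl.
by rewrite -natrD.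
Qed.

(** The three-term recurrence, which will put all monomials in the span of the Hermite polynomials.
    For n = 0 the coefficient [n%:R] cancels the meaningless [n.-1]. *)
Lemma hermite_poly_mulX n :
  'X * hermite_poly n = 2^-1 *: hermite_poly n.+1 + n%:R *: hermite_poly n.-1.
Proof.
have h : (hermite_poly n)^`() = (n * 2)%:R *: hermite_poly n.-1.
  by case: n => [|n]; [rewrite /= derivC scale0r|exact: deriv_hermite_poly].
rewrite hermite_polyS h scalerBr scalerA -scalerAl !scalerA mulVf ?pnatr_eq0// scale1r.
by rewrite natrM [n%:R * 2]mulrC mulKf ?pnatr_eq0// subrK.
Qed.

(** Rodrigues' formula: one more derivative turns H_n into H_n' - 2x H_n, that is, minus H_{n+1}. *)
Lemma derive1n_gauss n :
  derive1n n (fun y : R => expR (- y ^+ 2)) =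
  fun x => (-1) ^+ n * (hermite_poly n).[x] * gauss_weight 1 x.
Proof.
elim: n => [|n IH].
  by apply/funext => x; rewrite derive1n0 expr0 mul1r hornerE mul1r /gauss_weight mul1r.
rewrite derive1nS IH; apply/funext => x; rewrite derive1E.
have h := is_deriveZ ((-1) ^+ n) (is_deriveM (is_derive_poly (hermite_poly n) x) (is_derive_gauss_weight 1 x)).
have -> : (fun x => (-1) ^+ n * (hermite_poly n).[x] * gauss_weight 1 x) =
  (-1) ^+ n \*: (horner (hermite_poly n) * gauss_weight 1).
  by apply/funext => y; rewrite /= /GRing.scale/= mulrA.
have [_ ->] := h.
rewrite exprS hermite_polyS hornerD hornerN hornerM hornerZ hornerX /GRing.scale/=; ring.
Qed.

Lemma cvg_horner_gauss p :
  p.[n%:R] * gauss_weight 1 n%:R @[n --> \oo] --> 0 /\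
  p.[- n%:R] * gauss_weight 1 (- n%:R) @[n --> \oo] --> 0.
Proof.
have c2 : (0 : R) < 2^-1 by rewrite invr_gt0.
have [C hC] := horner_le_gauss p c2.
have C0 : C * gauss_weight 2^-1 n%:R @[n --> \oo] --> C * 0.
  by apply: cvgMl_tmp; exact: cvg_gauss_weight.
rewrite mulr0 in C0.
have bound x : `|p.[x] * gauss_weight 1 x| <= C * gauss_weight 2^-1 x.
  rewrite [X in gauss_weight X](splitr 1) !div1r -gauss_weightD mulrA normrM.
  rewrite normrM !(ger0_norm (gauss_weight_ge0 _ _)).
  by rewrite ler_wpM2r ?gauss_weight_ge0.
split; apply: (cvg_norm_le _ C0) => n; rewrite subr0 (le_trans (bound _))//.
by rewrite /gauss_weight sqrrN.
Qed.

Lemma gauss_int_by_parts p : gauss_int (2 *: 'X * p) = gauss_int p^`().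
Proof.
have [F0 F0'] := cvg_horner_gauss p.
have /eqP : gauss_int ((-1) *: (2 *: 'X * p) + p^`()) = 0.
  apply: (@integral_derive_eq0 _ (horner p * gauss_weight 1)) => //.
  - move=> x; apply: (is_derive_eq (is_deriveM (is_derive_poly p x) (is_derive_gauss_weight 1 x))).
    by rewrite hornerD hornerZ hornerM hornerZ hornerX /GRing.scale/=; ring.
  - by move=> x; apply: cvgM; [exact: continuous_horner|exact: continuous_gauss_weight].
by rewrite gauss_int_linear mulN1r addrC subr_eq0 => /eqP.
Qed.

(** For the Gaussian weight, the raising operator p -> 2X p - p' is the adjoint of the
    derivative. *)
Lemma gauss_int_hermiteS q n :
  gauss_int (q * hermite_poly n.+1) = gauss_int (q^`() * hermite_poly n).
Proof.
have -> : q * hermite_poly n.+1 =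
    (2 *: 'X) * (q * hermite_poly n) + (-1) *: (q * (hermite_poly n)^`()).
  by rewrite hermite_polyS scaleN1r mulrBr mulrCA.
rewrite addrC gauss_int_linear gauss_int_by_parts derivM mulN1r.
rewrite -[q^`() * _]scale1r gauss_int_linear mul1r.
by rewrite addrCA addNr addr0 scale1r.
Qed.

(** Moving the raising operator across lowers both indices by one, until one polynomial is the
    constant 1, whose derivative vanishes. *)
Lemma gauss_int_hermite m n :
  gauss_int (hermite_poly m * hermite_poly n) =
  if m == n then 2 ^+ n * n`!%:R * Num.sqrt pi else 0.
Proof.
elim: n m => [|n IH] [|m].
- by rewrite mulr1 gauss_int1 expr0 mul1r mul1r.
- by rewrite mulrC gauss_int_hermiteS derivC mul0r gauss_int0.
- by rewrite gauss_int_hermiteS derivC mul0r gauss_int0.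
rewrite gauss_int_hermiteS deriv_hermite_poly -scalerAl gauss_intZ IH eqSS.
case: eqP => [->|_]; last by rewrite mulr0.
by rewrite factS exprS !natrM; ring.
Qed.

Definition hermite_norm n : R := (pi `^ (1 / 4) * 2 `^ (n%:R / 2) * n`!%:R `^ (1 / 2))^-1.

Lemma hermite_normK n : hermite_norm n ^+ 2 * (2 ^+ n * n`!%:R * Num.sqrt pi) = 1.
Proof.
have E (x y : R) : 0 < x -> (x `^ y) ^+ 2 = x `^ (y * 2).
  by move=> x0; rewrite powRrM powR_mulrn// powR_ge0.
rewrite /hermite_norm exprVn !exprMn !E ?pi_gt0 ?ltr0n ?fact_gt0//.
rewrite divfK// powR_mulrn// divfK// powRr1//.
have -> : (1 / 4 * 2 : R) = 2^-1 by field.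
rewrite powR12_sqrt ?pi_ge0//.
have : Num.sqrt pi != 0 :> R by rewrite gt_eqF// sqrtr_gt0 pi_gt0.
have : n`!%:R != 0 :> R by rewrite pnatr_eq0 -lt0n fact_gt0.
by move=> h1 h2; field; rewrite h1 h2 expf_neq0.
Qed.

Lemma hermite_norm_neq0 n : hermite_norm n != 0.
Proof.
by apply/eqP => h; have := hermite_normK n; rewrite h expr0n mul0r => /eqP; rewrite eq_sym oner_eq0.
Qed.

Lemma hermite_functionE n x :
  hermite_function n x = (hermite_norm n *: hermite_poly n).[x] * gauss_weight 2^-1 x.
Proof.
rewrite /hermite_function derive1n_gauss hornerZ /hermite_norm.
rewrite -gauss_weight_half.
have -> : expR (x ^+ 2 / 2) = (gauss_weight 2^-1 x)^-1 :> R.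
  by rewrite /gauss_weight expRN invrK mulrC.
have g0 : gauss_weight 2^-1 x != 0 :> R by rewrite gt_eqF// expR_gt0.
set P := (hermite_poly n).[x]; set g := gauss_weight _ _ in g0 *.
set D := pi `^ (1 / 4) * 2 `^ (n%:R / 2) * n`!%:R `^ (1 / 2); set s : R := (-1) ^+ n.
have ss : s * s = 1 by rewrite -expr2 sqrr_sign.
(* The sign of the definition cancels the one from Rodrigues' formula, and one of the two factors
   e^{-x^2/2} cancels e^{x^2/2}. *)
transitivity ((s * s) * (D^-1 * P * g) * (g^-1 * g)); first by ring.
by rewrite ss mulVf// mul1r mulr1.
Qed.

Notation H2 := (LfunType leb (lee1n 2)).

Let pgm p : measurable_fun (setT : set (measurableTypeR R)) (fun x => p.[x] * gauss_weight 2^-1 x).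
Proof. by apply: measurable_funM; [exact: measurable_poly|exact: measurable_gauss_weight]. Qed.

Let pgsq p x : (p.[x] * gauss_weight 2^-1 x) ^+ 2 = (p * p).[x] * gauss_weight 1 x.
Proof.
by rewrite hornerM exprMn expr2 [X in _ * X]expr2 gauss_weight_half.
Qed.

Let pgi p : leb.-integrable setT (EFin \o (fun x => (p.[x] * gauss_weight 2^-1 x) ^+ 2)).
Proof. by under eq_fun do rewrite pgsq; exact: gi. Qed.

Definition poly_gauss p : H2 := mkL2 (@pgm p) (@pgi p).

Lemma poly_gauss_inner p q : L2_inner (poly_gauss p) (poly_gauss q) = gauss_int (p * q).
Proof.
by apply: eq_Rintegral => x _ /=; rewrite hornerM mulrACA gauss_weight_half.
Qed.

Lemma poly_gauss_linear a p q : poly_gauss (a *: p + q) = a *: poly_gauss p + poly_gauss q.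
Proof.
by apply/LfuneqP => x; rewrite /poly_gauss/= hornerD hornerZ mulrDl -mulrA.
Qed.

Definition hermite_L2 n : H2 := poly_gauss (hermite_norm n *: hermite_poly n).

Lemma hermite_L2E n : hermite_L2 n = hermite_function n :> (R -> R).
Proof. by apply/funext => x; rewrite hermite_functionE. Qed.

Lemma hermite_orthonormal i k : L2_inner (hermite_L2 i) (hermite_L2 k) = (i == k)%:R.
Proof.
rewrite poly_gauss_inner -scalerAl -scalerAr !gauss_intZ gauss_int_hermite.
by case: eqP => [->|_]; rewrite ?mulr0// mulrA -expr2 hermite_normK.
Qed.

End HermitePoly.

(** * Completeness of the Hermite functions *)

Section HermiteComplete.
Context (R : realType).
Notation leb := (@lebesgue_measure R).
Notation H2 := (LfunType leb (lee1n 2)).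

(* Convergence of the Hermite expansion to f encodes membership in the closed
   span of the Hermite functions. *)
Definition in_hermite_span (f : R -> R) : Prop :=
  exists F : H2, F = f :> (R -> R) /\ parseval_at (@L2_inner _ _ _ leb) (@hermite_L2 R) F.

Let hb := semi_inner_L2 leb.
Let he := @hermite_orthonormal R.

Lemma hermite_span_linear a f g : in_hermite_span f -> in_hermite_span g ->
  in_hermite_span (fun x => a * f x + g x).
Proof.
move=> [F [<- pF]] [G [<- pG]]; exists (a *: F + G); split; first by [].
exact: parseval_at_linear.
Qed.

Lemma hermite_span_poly (p : {poly R}) : in_hermite_span (fun x => p.[x] * gauss_weight 2^-1 x).
Proof.
pose S q := in_hermite_span (poly_gauss q).
have S_linear a q1 q2 : S q1 -> S q2 -> S (a *: q1 + q2).
  by move=> h1 h2; rewrite /S poly_gauss_linear; exact: (hermite_span_linear a h1 h2).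
have SZ a q : S q -> S (a *: q).
  move=> h; have := S_linear a _ _ h (S_linear (-1) _ _ h h).
  by rewrite scaleN1r addNr addr0.
have S_hermite n : S (hermite_poly R n).
  have : S (hermite_norm R n *: hermite_poly R n).
    by exists (hermite_L2 R n); split => //; exact: parseval_at_basis.
  move/(SZ (hermite_norm R n)^-1).
  by rewrite scalerA mulVf ?hermite_norm_neq0// scale1r.
(* Induction on k for all n at once, because X H_n involves both neighbours of H_n; n = 0 gives the
   monomials. *)
have SX k n : S ('X^k * hermite_poly R n).
  elim: k n => [|k IH] n; first by rewrite expr0 mul1r.
  rewrite exprSr -mulrA hermite_poly_mulX mulrDr -!scalerAr.
  by apply: S_linear => //; exact: SZ.
rewrite -[p]coefK poly_def.
have : S (\sum_(i < size p) p`_i *: 'X^i).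
  elim/big_ind : _ => [|q1 q2 h1 h2|i _].
  - by have := SZ 0 _ (S_hermite 0%N); rewrite scale0r.
  - by rewrite -[q1]scale1r; exact: S_linear.
  - by apply: SZ; have := SX i 0%N; rewrite mulr1.
by [].
Qed.

(** Dominated convergence applied to (f - f_n)^2 <= 4 g^2 gives convergence in L^2, and the closed
    span absorbs the limit. *)
Lemma hermite_span_lim (f_ : nat -> R -> R) (f g : R -> R) :
  (forall n, in_hermite_span (f_ n)) -> (forall x, f_ n x @[n --> \oo] --> f x) ->
  (forall n x, `|f_ n x| <= g x) -> measurable_fun setT g ->
  leb.-integrable setT (EFin \o (fun x => g x ^+ 2)) ->
  in_hermite_span f.
Proof.
move=> Sf f_f fg mg ig.
have mf_ n : measurable_fun (setT : set (measurableTypeR R)) (f_ n).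
  by have [F [<- _]] := Sf n; exact: L2_measurable.
have g0 x : 0 <= g x by rewrite (le_trans _ (fg 0%N x)).
have f_le x : `|f x| <= g x.
  have fx : `|f_ n x| @[n --> \oo] --> `|f x| by exact: cvg_norm.
  rewrite -(cvg_lim _ fx)//; apply: limr_le; first by apply/cvg_ex; exists `|f x|.
  exact: nearW.
have mf : measurable_fun (setT : set (measurableTypeR R)) f.
  exact: Rcvg_measurable mf_ f_f.
have if2 : leb.-integrable setT (EFin \o (fun x => f x ^+ 2)).
  apply: le_integrable ig => //; first by apply/measurable_EFinP; exact: measurable_funX.
  by move=> x _ /=; rewrite lee_fin !normrX lerXn2r// ?nnegrE// (le_trans (f_le x))// ler_norm.
pose F : H2 := mkL2 mf if2.
exists F; split => //; apply: parseval_at_closed => // eps eps0.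
have /cvgrPdist_lt/(_ _ eps0) : \int[leb]_x (f x - f_ n x) ^+ 2 @[n --> \oo] --> \int[leb]_x (0 : R).
  apply: (@Rdominated_cvg _ _ _ leb _ _ (fun x => 4 * g x ^+ 2)).
  - by move=> n; apply: measurable_funX; exact: measurable_funB.
  - move=> x; have h : f x - f_ n x @[n --> \oo] --> f x - f x.
      by apply: cvgB; [exact: cvg_cst|exact: f_f].
    by rewrite subrr in h; exact: cvg_sqr0.
  - exact: (integrableZl measurableT 4 ig).
  - move=> n x; rewrite ger0_norm ?sqr_ge0//.
    have := fg n x; have := f_le x; rewrite !ler_norml => /andP[a1 a2] /andP[a3 a4].
    have : `|f x - f_ n x| <= 2 * g x by rewrite ler_norml; lra.
    rewrite -(@ler_pXn2r _ 2) ?nnegrE// ?mulr_ge0// real_normK ?num_real//.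
    by rewrite exprMn -natrX.
rewrite Rintegral_cst// mul0r => -[N _ /(_ N (leqnn N))] /=.
rewrite sub0r normrN ger0_norm => [h|]; last by apply: Rintegral_ge0 => x _; exact: sqr_ge0.
have [G [GE pG]] := Sf N; exists G => //.
rewrite L2_inner_sqr; apply: le_lt_trans h; rewrite le_eqVlt; apply/orP; left; apply/eqP.
by apply: eq_Rintegral => x _; rewrite -GE.
Qed.

Lemma norm_series_le_expR (u : nat -> R) (y : R) n :
  (forall k, `|u k| <= `|y| ^+ k / k`!%:R) -> `|series u n| <= expR `|y|.
Proof.
move=> h; rewrite /series/= (le_trans (ler_norm_sum _ _ _))//.
apply: (@le_trans _ _ (series (exp_coeff `|y|) n)).
  by rewrite /series/=; apply: ler_sum => k _; exact: h.
rewrite /expR; apply: (nondecreasing_cvgn_le (u_ := series (exp_coeff `|y|))); last exact: is_cvg_series_exp_coeff.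
by apply: nondecreasing_series => k _ _; exact: exp_coeff_ge0.
Qed.

(** The Taylor sums of sine and cosine, times e^{-x^2/2}, are polynomials times that factor. All of
    them are bounded by 2 e^{|t x|} e^{-x^2/2}, which gives the majorant for the limit. *)
Lemma hermite_span_cos (t a : R) :
  in_hermite_span (fun x => cos (t * x + a) * gauss_weight 2^-1 x).
Proof.
pose u (b : bool) (y : R) : nat -> R := if b then sin_coeff y else cos_coeff y.
have u_poly b n : exists p : {poly R}, forall x, p.[x] = series (u b (t * x)) n.
  elim: n => [|n [p ph]].
    by exists 0 => x; rewrite horner0 /series/= big_geq.
  exists (p + (u b t n) *: 'X^n) => x.
  rewrite seriesSr hornerD ph hornerZ hornerXn; congr (_ + _).
  by rewrite /u; case: (b); rewrite /sin_coeff /cos_coeff/= exprMn; ring.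
have u_le b y k : `|u b y k| <= `|y| ^+ k / k`!%:R.
  rewrite /u; case: b; rewrite /sin_coeff /cos_coeff/= !normrM normrX normrV ?unitfE ?pnatr_eq0 -?lt0n ?fact_gt0//.
    rewrite normrN1 expr1n mulr1 normrX !normr_nat ler_wpM2r ?invr_ge0//.
    by rewrite ler_piMl ?exprn_ge0// lern1 leq_b1.
  rewrite normrN1 expr1n mulr1 normrX !normr_nat ler_wpM2r ?invr_ge0//.
  by rewrite ler_piMl ?exprn_ge0// lern1 leq_b1.
pose f_ n x := (cos a * series (u false (t * x)) n - sin a * series (u true (t * x)) n) * gauss_weight 2^-1 x.
(* From |t x| <= t^2 + x^2/4: half of the Gaussian exponent pays for the exponential and the other
   half is kept. *)
pose g x := 2 * expR (t ^+ 2) * gauss_weight 4^-1 x.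
apply: (@hermite_span_lim f_ _ g).
- move=> n; have [p hp] := u_poly false n; have [q hq] := u_poly true n.
  have := hermite_span_poly (cos a *: p - sin a *: q).
  congr in_hermite_span; apply/funext => x.
  by rewrite hornerD hornerN !hornerZ hp hq.
- move=> x; rewrite addrC cosD; apply: cvgMr_tmp; apply: cvgB; apply: cvgMl_tmp.
    by rewrite cos.unlock; exact: is_cvg_series_cos_coeff.
  by rewrite sin.unlock; exact: is_cvg_series_sin_coeff.
- move=> n x; rewrite /f_ normrM (ger0_norm (gauss_weight_ge0 _ _)).
  apply: (@le_trans _ _ (2 * expR `|t * x| * gauss_weight 2^-1 x)).
    rewrite ler_wpM2r ?gauss_weight_ge0// (le_trans (ler_normB _ _))// (normrM (cos a)) (normrM (sin a)) mulr_natl mulr2n.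
    by rewrite lerD// -[leRHS]mul1r ler_pM// ?cos_max ?sin_max// norm_series_le_expR.
  rewrite /g -!mulrA ler_wpM2l// /gauss_weight -!expRD ler_expR normrM.
  have := sqr_ge0 (`|t| - `|x| / 2); have := real_normK (num_real t); have := real_normK (num_real x).
  lra.
- by apply: measurable_funM => //; exact: measurable_gauss_weight.
- have c2 : (0 : R) < 2^-1 by rewrite invr_gt0.
  apply: (gauss_dominated_integrable (C := (2 * expR (t ^+ 2)) ^+ 2) c2).
    by apply: measurable_funX; apply: measurable_funM => //; exact: measurable_gauss_weight.
  move=> x; rewrite ger0_norm ?sqr_ge0// /g exprMn expr2 [X in _ * X]expr2 gauss_weightD.
  by rewrite (_ : 4^-1 + 4^-1 = 2^-1 :> R)//; field.
Qed.

(** A bounded limit becomes a dominated one: a bound M on h is the square-integrable majorant M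
    e^{-x^2/2} of the product. *)
Lemma hermite_span_trig (h : R -> R) : trig_closure h ->
  in_hermite_span (fun x => h x * gauss_weight 2^-1 x).
Proof.
elim=> [t a|k f g _ IHf _ IHg|f_ g M _ IH fM fg].
- exact: hermite_span_cos.
- have := hermite_span_linear k IHf IHg.
  by congr in_hermite_span; apply/funext => x; ring.
- apply: (hermite_span_lim (g := fun x => M * gauss_weight 2^-1 x) IH) => [x|n x||].
  + exact: cvgMr_tmp.
  + by rewrite normrM (ger0_norm (gauss_weight_ge0 _ _)) ler_wpM2r ?gauss_weight_ge0.
  + by apply: measurable_funM => //; exact: measurable_gauss_weight.
  + apply: (gauss_dominated_integrable (C := M ^+ 2) (@ltr01 R)).
      by apply: measurable_funX; apply: measurable_funM => //; exact: measurable_gauss_weight.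
    by move=> x; rewrite ger0_norm ?sqr_ge0// exprMn [X in _ * X]expr2 gauss_weight_half.
Qed.

(** Divide F by e^{-x^2/2} and cut the quotient h off where it exceeds n. The truncations are
    bounded, so the previous lemma applies to them, and their products with the Gaussian converge to
    F under the majorant |F|. *)
Theorem hermite_complete (F : H2) : parseval_at (@L2_inner _ _ _ leb) (@hermite_L2 R) F.
Proof.
suff [G [GF pG]] : in_hermite_span F by have -> : F = G by apply/LfuneqP => x; rewrite GF.
pose h x := F x * expR (2^-1 * x ^+ 2).
have hE x : h x * gauss_weight 2^-1 x = F x.
  by rewrite /h -mulrA /gauss_weight -expRD subrr expR0 mulr1.
have mh : measurable_fun setT h.
  apply: measurable_funM; first exact: L2_measurable.
  apply: (measurableT_comp (f := @expR R)) => //.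
  by apply: measurable_funM => //; exact: measurable_funX.
pose A n := [set x | `|h x| <= n%:R].
have mA n : measurable (A n).
  rewrite (_ : A n = (fun x => `|h x|) @^-1` `]-oo, n%:R]); last first.
    by apply/seteqP; split => x; rewrite /A/= in_itv.
  rewrite -[X in measurable X]setTI.
  have mnh : measurable_fun setT (fun x => `|h x|) by exact: measurableT_comp.
  exact: mnh.
pose h_ n x := h x * \1_(A n) x.
have mh_ n : measurable_fun (setT : set (measurableTypeR R)) (h_ n).
  by apply: measurable_funM => //; exact: measurable_indic.
have h_le n x : `|h_ n x| <= n%:R.
  rewrite /h_ indicE; case: (boolP (x \in A n)) => [/set_mem|] xA.
    by rewrite mulr1.
  by rewrite mulr0 normr0.
apply: (@hermite_span_lim (fun n x => h_ n x * gauss_weight 2^-1 x) _ (fun x => `|F x|)).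
- move=> n; apply: hermite_span_trig; apply: (@trig_closure_bounded _ _ n%:R) => //.
  exact: mh_.
- move=> x; apply: (cvg_near_cst _ _ (F := \oo)); near=> n.
  rewrite /h_ indicE mem_set ?mulr1 ?hE// /A/=.
  by near: n; exact: nbhs_infty_ger.
- move=> n x; rewrite -[in leRHS]hE /h_ mulrAC normrM indicE ler_piMr//.
  by rewrite normr_nat lern1 leq_b1.
- have mF : measurable_fun (setT : set (measurableTypeR R)) (fun x => `|F x|).
    by apply: measurableT_comp => //; exact: L2_measurable.
  exact: mF.
- have := L2_sqr_integrable F; apply: eq_integrable => // x _ /=.
  by rewrite real_normK ?num_real.
Unshelve. all: by end_near. Qed.

Lemma hermite_parseval (f g : R -> R) :
  measurable_fun setT f -> measurable_fun setT g ->
  leb.-integrable setT (EFin \o (fun x => f x ^+ 2)) ->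
  leb.-integrable setT (EFin \o (fun x => g x ^+ 2)) ->
  \sum_(0 <= n < N) (\int[leb]_x (f x * hermite_function n x)) *
     (\int[leb]_x (g x * hermite_function n x)) @[N --> \oo] -->
  \int[leb]_x (f x * g x).
Proof.
move=> mf mg f2 g2.
pose F : H2 := mkL2 (mf : measurable_fun (setT : set (measurableTypeR R)) f) f2.
pose G : H2 := mkL2 (mg : measurable_fun (setT : set (measurableTypeR R)) g) g2.
have := parseval hb (z := G) (hermite_complete F).
have E (K : H2) n : L2_inner K (hermite_L2 R n) = \int[leb]_x (K x * hermite_function n x).
  by apply: eq_Rintegral => x _; rewrite hermite_L2E.
have -> : (fun n => \sum_(0 <= i < n) L2_inner F (hermite_L2 R i) * L2_inner G (hermite_L2 R i)) =
  (fun N => \sum_(0 <= n < N) (\int[leb]_x (f x * hermite_function n x)) *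
     (\int[leb]_x (g x * hermite_function n x))).
  by apply/funext => n; apply: eq_bigr => i _; rewrite !E.
exact.
Qed.

Lemma hermite_bessel (f : R -> R) n :
  measurable_fun setT f ->
  leb.-integrable setT (EFin \o (fun x => f x ^+ 2)) ->
  \sum_(i < n) (\int[leb]_x (f x * hermite_function i x)) ^+ 2 <= \int[leb]_x (f x ^+ 2).
Proof.
move=> mf f2.
pose F : H2 := mkL2 (mf : measurable_fun (setT : set (measurableTypeR R)) f) f2.
have := bessel hb he n F; rewrite L2_inner_sqr; apply: le_trans.
rewrite le_eqVlt; apply/orP; left; apply/eqP; apply: eq_bigr => i _; congr (_ ^+ 2).
by apply: eq_Rintegral => x _; rewrite hermite_L2E.
Qed.

End HermiteComplete.

(** * Gaussian laws *)

Section LawUniqueness.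
Context (R : realType).

Lemma trig_measurable (f : R -> R) : trig_closure f -> measurable_fun setT f.
Proof.
elim=> [t a|k g h _ mg _ mh|f_ g M _ mf_ _ fg].
- exact: measurable_cosL.
- by apply: measurable_funD => //; exact: measurable_funM.
- exact: Rcvg_measurable mf_ fg.
Qed.

Lemma bounded_weight_integrable d (T : measurableType d) (mu : {measure set T -> \bar R})
  (u w : T -> R) M : measurable_fun setT u -> (forall x, `|u x| <= M) ->
  (forall x, 0 <= w x) -> mu.-integrable setT (EFin \o w) ->
  mu.-integrable setT (EFin \o (fun x => u x * w x)).
Proof.
move=> mu_ uM w0 iw; have mw : measurable_fun setT w.
  by apply/measurable_EFinP; exact: (measurable_int _ iw).
apply: (@le_integrable _ _ _ mu _ measurableT _ (fun x => (M%:E * (w x)%:E)%E)).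
- by apply/measurable_EFinP; exact: measurable_funM.
- move=> x _ /=; rewrite lee_fin normrM ler_normr; apply/orP; left.
  by rewrite (ger0_norm (w0 x)) ler_wpM2r.
- exact: integrableZl.
Qed.

Context d1 (T1 : measurableType d1) (mu1 : {measure set T1 -> \bar R}) (X1 w1 : T1 -> R).
Context d2 (T2 : measurableType d2) (mu2 : {measure set T2 -> \bar R}) (X2 w2 : T2 -> R).
Hypothesis mX1 : measurable_fun setT X1.
Hypothesis mX2 : measurable_fun setT X2.
Hypothesis w10 : forall x, 0 <= w1 x.
Hypothesis w20 : forall x, 0 <= w2 x.
Hypothesis iw1 : mu1.-integrable setT (EFin \o w1).
Hypothesis iw2 : mu2.-integrable setT (EFin \o w2).
Hypothesis cos12 : forall t a,
  \int[mu1]_x (cos (t * X1 x + a) * w1 x) = \int[mu2]_x (cos (t * X2 x + a) * w2 x).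

(** Induction on the closure, the limit step being dominated by M times the weight. The weights
    allow a comparison of a random variable (weight 1) with a density on the line. *)
Theorem law_unique (g : R -> R) M : measurable_fun setT g -> (forall x, `|g x| <= M) ->
  \int[mu1]_x (g (X1 x) * w1 x) = \int[mu2]_x (g (X2 x) * w2 x).
Proof.
move=> mg gM; have := trig_closure_bounded mg gM.
move: g M mg gM => g _ _ _.
elim=> [t a|k f h cf IHf ch IHh|f_ f M cf_ IH fM ff].
- exact: cos12.
- have [Mf bf] := trig_bounded cf; have [Mh bh] := trig_bounded ch.
  have mf := trig_measurable cf; have mh := trig_measurable ch.
  have E d (T : measurableType d) (mu : {measure set T -> \bar R}) (X w : T -> R) :
      measurable_fun setT X -> (forall x, 0 <= w x) -> mu.-integrable setT (EFin \o w) ->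
      \int[mu]_x ((k * f (X x) + h (X x)) * w x) =
      k * \int[mu]_x (f (X x) * w x) + \int[mu]_x (h (X x) * w x).
    move=> mX w0 iw.
    have if_ := bounded_weight_integrable (measurableT_comp mf mX) (fun x => bf (X x)) w0 iw.
    have ih_ := bounded_weight_integrable (measurableT_comp mh mX) (fun x => bh (X x)) w0 iw.
    rewrite -RintegralZl// -RintegralD//; last exact: (integrableZl measurableT k if_).
    by apply: eq_Rintegral => x _; rewrite mulrDl mulrA.
  by rewrite !E// IHf IHh.
- have E d (T : measurableType d) (mu : {measure set T -> \bar R}) (X w : T -> R) :
      measurable_fun setT X -> (forall x, 0 <= w x) -> mu.-integrable setT (EFin \o w) ->
      \int[mu]_x (f_ n (X x) * w x) @[n --> \oo] --> \int[mu]_x (f (X x) * w x).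
    move=> mX w0 iw; have mw : measurable_fun setT w.
      by apply/measurable_EFinP; exact: (measurable_int _ iw).
    apply: (@Rdominated_cvg _ _ _ mu _ _ (fun x => M * w x)).
    + move=> n; apply: measurable_funM => //.
      by apply: measurableT_comp mX; exact: trig_measurable.
    + by move=> x; apply: cvgMr_tmp; exact: ff.
    + exact: (integrableZl measurableT M iw).
    + by move=> n x; rewrite normrM (ger0_norm (w0 x)) ler_wpM2r.
  have e1 := E _ _ _ _ _ mX1 w10 iw1; have e2 := E _ _ _ _ _ mX2 w20 iw2.
  rewrite -(cvg_lim _ e1)// -(cvg_lim _ e2)//.
  by congr (lim (_ @ \oo)); apply/funext => n.
Qed.

End LawUniqueness.

Section GaussianLaw.
Context (R : realType) d (T : measurableType d) (P : probability T R).
Notation leb := (@lebesgue_measure R).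

Let iP : P.-integrable setT (EFin \o (fun=> 1 : R)).
Proof. exact: finite_measure_integrable_cst. Qed.

Lemma Rintegral_probability_cst (r : R) : \int[P]_x r = r.
Proof.
rewrite Rintegral_cst//.
have -> : (P : {measure set T -> \bar R}) setT = 1%E by exact: probability_setT.
by rewrite mulr1.
Qed.

(** The factor 1 is the trivial weight, which puts the probability in the form of [law_unique]. *)
Lemma probability_preimage (X : T -> R) (A : set R) :
  measurable_fun setT X -> measurable A ->
  P (X @^-1` A) = (\int[P]_x (\1_A (X x) * 1))%:E.
Proof.
move=> mX mA.
have mXA : measurable (X @^-1` A) by rewrite -[X in measurable X]setTI; exact: mX.
rewrite /Rintegral; under eq_integral do rewrite mulr1.
have -> : (\int[P]_x (\1_A (X x))%:E = \int[P]_x (\1_(X @^-1` A) x)%:E)%E by [].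
rewrite integral_indic// setIT fineK//; exact: fin_num_measure.
Qed.

(** X is compared with the constant 0 if s = 0, and otherwise with the identity on the line weighted
    by the normal density, whose cosine integrals are given by [gauss_characteristic]. *)
Theorem gaussian_law_characteristic (X : T -> R) (s : R) : 0 <= s ->
  measurable_fun setT X ->
  (forall t a, \int[P]_x cos (t * X x + a) = cos a * expR (- (t ^+ 2 * s ^+ 2 / 2))) ->
  forall A : set R, measurable A -> P (X @^-1` A) = gaussian_law 0 s A.
Proof.
move=> s0 mX ch A mA; rewrite probability_preimage//.
have mI : measurable_fun setT (\1_A : R -> R) by exact: measurable_indic.
have bI x : `|\1_A x : R| <= 1 by rewrite indicE normr_nat lern1 leq_b1.
have chX t a : \int[P]_x (cos (t * X x + a) * 1) = cos a * expR (- (t ^+ 2 * s ^+ 2 / 2)).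
  by rewrite -ch; apply: eq_Rintegral => x _; rewrite mulr1.
rewrite /gaussian_law; case: eqVneq => [sE|s_neq0].
  rewrite (@law_unique _ _ _ P X (fun=> 1) _ _ P (fun=> 0) (fun=> 1) _ _ _ _ _ _ _ _ 1)//.
    by rewrite Rintegral_probability_cst mulr1 diracE indicE.
  move=> t a; rewrite chX sE expr0n/= mulr0 mul0r oppr0 expR0 mulr1.
  under eq_Rintegral do rewrite mulr0 add0r mulr1.
  by rewrite Rintegral_probability_cst.
pose w := normal_pdf (0 : R) s.
have wE x : w x = normal_peak s * gauss_weight (2 * s ^+ 2)^-1 x.
  rewrite /w normal_pdfE//; congr (_ * _); rewrite /normal_fun /gauss_weight subr0 -mulr_natl.
  by congr expR; field.
have c0 : 0 < (2 * s ^+ 2)^-1 by rewrite invr_gt0 mulr_gt0// exprn_even_gt0.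
have iw : leb.-integrable setT (EFin \o w) by exact: integrable_normal_pdf.
have w1 : \int[leb]_x w x = 1 by rewrite /Rintegral integral_normal_pdf.
have ws : normal_peak s * \int[leb]_x gauss_weight (2 * s ^+ 2)^-1 x = 1.
  rewrite -RintegralZl//; last exact: gauss_weight_integrable.
  by rewrite -[RHS]w1; apply: eq_Rintegral => x _; rewrite wE.
rewrite (@law_unique _ _ _ P X (fun=> 1) _ _ leb id w _ _ _ _ _ _ _ _ 1)//.
- rewrite /normal_prob integral_mkcond /Rintegral fineK.
    by apply: eq_integral => x _; rewrite patchE indicE; case: ifPn; rewrite ?mul1r ?mul0r.
  apply: integrable_fin_num => //.
  by apply: (bounded_weight_integrable (M := 1) (mu := leb) (u := \1_A)) => // x; exact: normal_pdf_ge0.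
- by move=> x; exact: normal_pdf_ge0.
- move=> t a; rewrite chX.
  under [RHS]eq_Rintegral do rewrite wE mulrCA.
  rewrite RintegralZl//; last first.
    apply: (bounded_weight_integrable (M := 1)).
    + exact: measurable_cosL.
    + by move=> x; exact: cos_max.
    + exact: gauss_weight_ge0.
    + exact: gauss_weight_integrable.
  rewrite (gauss_characteristic a c0 t) [RHS]mulrCA.
  rewrite ws mulr1; congr (_ * expR (- _)).
  by field.
Qed.

End GaussianLaw.

Section AlmostEverywhere.
Context (R : realType) d (T : measurableType d) (mu : {measure set T -> \bar R}).

Lemma ae_eq_Rintegral (f g : T -> R) : measurable_fun setT f -> measurable_fun setT g ->
  f = g %[ae mu] -> \int[mu]_x f x = \int[mu]_x g x.
Proof.
move=> mf mg fg; congr fine; apply: ae_eq_integral => //.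
- exact/measurable_EFinP.
- exact/measurable_EFinP.
- by apply: filterS fg => x /= h _; rewrite h.
Qed.

Notation L2m := (LfunType mu (lee1n 2)).

Lemma ae_eq_L2_inner (f f' g g' : L2m) : f = f' %[ae mu] -> g = g' %[ae mu] ->
  L2_inner f g = L2_inner f' g'.
Proof.
move=> ff gg; apply: ae_eq_Rintegral.
- by apply: measurable_funM; exact: L2_measurable.
- by apply: measurable_funM; exact: L2_measurable.
- by apply: filterS2 ff gg => x h1 h2 _; rewrite h1// h2.
Qed.

Lemma ae_eq_L2_linear a (f f' g g' : L2m) : f = f' %[ae mu] -> g = g' %[ae mu] ->
  a *: f + g = a *: f' + g' %[ae mu].
Proof.
move=> ff gg; apply: filterS2 ff gg => x h1 h2 _.
by rewrite /= -[LHS]/(a * f x + g x) h1// h2.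
Qed.

End AlmostEverywhere.

Section Trig.
Context (R : realType).

Lemma cos_lipschitz (x y : R) : `|cos x - cos y| <= `|x - y|.
Proof.
wlog xy : x y / y <= x.
  by move=> h; have [|/ltW] := leP y x => // /h //; rewrite distrC [leRHS]distrC.
have [c _ ->] := @MVT_segment _ cos (fun x => - sin x) y x xy
  (fun x _ => is_derive_cos x) (continuous_subspaceT (@continuous_cos R)).
by rewrite normrM normrN ler_piMl// sin_max.
Qed.

Lemma norm_sin_le (x : R) : `|sin x| <= `|x|.
Proof.
have := cos_lipschitz (x - pi / 2) (- (pi / 2)).
by rewrite cosBpihalf cosN cos_pihalf subr0 opprK subrK.
Qed.

Lemma norm_onem_cos_le (x : R) : `|1 - cos x| <= `|x|.
Proof. by have := cos_lipschitz x 0; rewrite cos0 subr0 distrC. Qed.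

End Trig.

Lemma eq_seq_cvg (R : realType) (u v : nat -> R) (l : R) :
  u =1 v -> u n @[n --> \oo] --> l -> v n @[n --> \oo] --> l.
Proof. by move=> /funext ->. Qed.

Section CosRandomVariable.
Context (R : realType) d (T : measurableType d) (P : probability T R).
Variables (X : T -> R) (mX : measurable_fun setT X).

Lemma measurable_cosX a : measurable_fun setT (fun w => cos (X w + a)).
Proof.
have := measurableT_comp (measurable_cosL 1 a) mX.
by congr measurable_fun; apply/funext => w /=; rewrite mul1r.
Qed.

Lemma bounded_integrable (u : T -> R) M : measurable_fun setT u ->
  (forall x, `|u x| <= M) -> P.-integrable setT (EFin \o u).
Proof.
move=> mu uM; have i1 : P.-integrable setT (EFin \o (fun=> 1 : R)).
  exact: finite_measure_integrable_cst.
have h := bounded_weight_integrable mu uM (fun=> ler01) i1.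
by apply: eq_integrable h => // w _ /=; rewrite mulr1.
Qed.

Lemma integrable_cosX a : P.-integrable setT (EFin \o (fun w => cos (X w + a))).
Proof. by apply: (bounded_integrable (measurable_cosX a)) => w; exact: cos_max. Qed.

End CosRandomVariable.

(** * White noise *)

Lemma measurable_pairing (R : realType) (s : schwartz R) :
  measurable_fun setT (fun w : tempered_space R => (w : tempered R) s).
Proof.
move=> _ A mA; apply: sub_sigma_algebra; exists s => //.
by exists A.
Qed.

Lemma L2_Lfun1 (R : realType) d (T : measurableType d) (P : probability T R) (Y : L2 P) :
  (Y : T -> R) \in Lfun P 1.
Proof. by apply: (Lfun_subset12 _ (LfunP Y)); exact: fin_num_measure. Qed.

Section Noise.
Context (R : realType).
Variables (sigma : {measure set (measurableTypeR R) -> \bar R}).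
Variables (H : completeNormedModType R) (ip : {dot H for idfun}).
Variables (j : {linear schwartz R -> H}) (H_completion : is_completion sigma ip j).
Variables (P : probability (tempered_space R) R) (P_noise : is_white_noise sigma P).
Variables (Q : H -> L2 P) (Q_iso : is_noise_isometry j Q).

Let b (x y : H) : R := ip x y.
Notation bP := (@L2_inner R _ _ P).

Lemma semi_inner_dot : semi_inner b.
Proof.
split=> [x y|a x y z|x]; rewrite /b.
- by rewrite (hermC ip) expr0 mul1r.
- by rewrite linearPl.
- by rewrite -(completion_norm H_completion) sqr_ge0.
Qed.

Lemma noise_norm x : bP (Q x) (Q x) = b x x.
Proof.
have := noise_isometry Q_iso x; rewrite Lnorm2E => -[h].
rewrite /b -(completion_norm H_completion) -h sqr_sqrtr//.
exact: (inner_ge0 (semi_inner_L2 P)).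
Qed.

Lemma noise_lin a x y : Q (a *: x + y) = a *: Q x + Q y %[ae P].
Proof. exact: noise_linear Q_iso a x y. Qed.

Lemma noiseD x y : Q (x + y) = Q x + Q y %[ae P].
Proof. by have := noise_lin 1 x y; rewrite !scale1r. Qed.

Lemma noise0 : Q 0 = 0 %[ae P].
Proof.
by have := noise_lin (-1) 0 0; rewrite scaler0 addr0 scaleN1r addNr.
Qed.

Lemma noiseZ a x : Q (a *: x) = a *: Q x %[ae P].
Proof.
have h := noise_lin a x 0; rewrite addr0 in h.
apply: filterS2 h noise0 => w h1 h2 _; rewrite h1// -[LHS]/(a * Q x w + Q 0 w) h2//.
by rewrite -[RHS]/(a * Q x w) -[X in _ + X]/(0 : R) addr0.
Qed.

Lemma noiseB x y : Q (x - y) = Q x - Q y %[ae P].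
Proof.
have h := noise_lin (-1) y x; rewrite scaleN1r addrC in h.
by have -> : Q x - Q y = -1 *: Q y + Q x by rewrite scaleN1r addrC.
Qed.

Lemma noise_distance x y : bP (Q x - Q y) (Q x - Q y) = b (x - y) (x - y).
Proof. by rewrite -noise_norm; apply: ae_eq_L2_inner; apply: ae_eq_sym; exact: noiseB. Qed.

(** Polarization of [noise_norm], additivity of Q being available almost surely. *)
Lemma noise_inner x y : bP (Q x) (Q y) = b x y.
Proof.
have h := noise_norm (x + y).
rewrite (ae_eq_L2_inner (noiseD x y) (noiseD x y)) in h.
rewrite (inner_sqD (semi_inner_L2 P)) (inner_sqD semi_inner_dot) !noise_norm in h.
lra.
Qed.

Lemma noise_sum n (c : nat -> R) (e : nat -> H) :
  Q (\sum_(i < n) c i *: e i) = \sum_(i < n) c i *: Q (e i) %[ae P].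
Proof.
elim: n => [|n IH]; first by rewrite !big_ord0; exact: noise0.
rewrite !big_ord_recr/= addrC [X in _ = X %[ae P]]addrC.
apply: ae_eq_trans (noise_lin _ _ _) _.
by apply: ae_eq_L2_linear => //; exact: ae_eq_refl.
Qed.

Lemma normc_sqr (z : R[i]) : complex.ComplexField.Normc.normc z ^+ 2 =
  complex.Re (z^*%C * z).
Proof.
case: z => x y /=; rewrite sqr_sqrtr ?addr_ge0 ?sqr_ge0//.
by rewrite !expr2; ring.
Qed.

Lemma noise_variance s :
  b (j s) (j s) = \int[sigma]_u (complex.ComplexField.Normc.normc (fourier s u) ^+ 2).
Proof.
rewrite /b (completion_ip H_completion) /fourier_ip.
by under [RHS]eq_Rintegral do rewrite normc_sqr.
Qed.

(** The real part of the characteristic function gives the integral of the cosine, the imaginary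
    part says that the sine integrates to 0; the addition formula brings in the phase. *)
Lemma noise_cos_j s a :
  \int[P]_w cos (Q (j s) w + a) = cos a * expR (- (2^-1 * b (j s) (j s))).
Proof.
have mw := measurable_pairing s.
have := P_noise s; rewrite -noise_variance /Cintegral /= => -[hc hs].
rewrite hc; transitivity (\int[P]_w cos ((w : tempered R) s + a)).
  apply: ae_eq_Rintegral.
  - by apply: measurable_cosX; exact: L2_measurable.
  - exact: measurable_cosX.
  - by apply: filterS (noise_pairing Q_iso s) => w h _; rewrite h.
transitivity (\int[P]_w (cos a * cos ((w : tempered R) s + 0) -
                         sin a * cos ((w : tempered R) s + (- (pi / 2))))).
  by apply: eq_Rintegral => w _; rewrite cosD addr0 cosBpihalf; ring.
rewrite RintegralB//; last 2 first.
- exact: (integrableZl measurableT (cos a) (integrable_cosX P mw 0)).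
- exact: (integrableZl measurableT (sin a) (integrable_cosX P mw (- (pi / 2)))).
rewrite !RintegralZl//; try exact: integrable_cosX.
have -> : \int[P]_w cos ((w : tempered R) s + (- (pi / 2))) = 0.
  by rewrite [RHS]hs; apply: eq_Rintegral => w _; rewrite cosBpihalf.
rewrite mulr0 subr0; congr (_ * _).
by apply: eq_Rintegral => w _; rewrite addr0.
Qed.

Lemma noise_cos x a :
  \int[P]_w cos (Q x w + a) = cos a * expR (- (2^-1 * b x x)).
Proof.
pose phi y := \int[P]_w cos (Q y w + a).
(* Cauchy-Schwarz against the constant 1, of norm 1 for a probability, together with the Lipschitz
   bound for the cosine and the isometry of Q. *)
have phi_lip y z : (phi y - phi z) ^+ 2 <= b (y - z) (y - z).
  pose h w := cos (Q y w + a) - cos (Q z w + a).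
  have my := @measurable_cosX _ _ _ _ (L2_measurable (Q y)) a.
  have mz := @measurable_cosX _ _ _ _ (L2_measurable (Q z)) a.
  have iy := @integrable_cosX _ _ _ P _ (L2_measurable (Q y)) a.
  have iz := @integrable_cosX _ _ _ P _ (L2_measurable (Q z)) a.
  have mh : measurable_fun setT h by exact: measurable_funB.
  have hle w : h w ^+ 2 <= (Q y w - Q z w) ^+ 2.
    rewrite -(real_normK (num_real (h w))) -[leRHS](real_normK (num_real _)).
    rewrite lerXn2r ?nnegrE// (le_trans (cos_lipschitz _ _))//.
    by rewrite opprD addrACA subrr addr0.
  have h2 : P.-integrable setT (EFin \o (fun w => h w ^+ 2)).
    apply: le_integrable (L2_sqr_integrable (Q y - Q z)) => //.
      by apply/measurable_EFinP; exact: measurable_funX.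
    by move=> w _ /=; rewrite lee_fin !ger0_norm ?sqr_ge0//; exact: hle.
  have o2 : P.-integrable setT (EFin \o (fun=> 1 ^+ 2 : R)).
    exact: finite_measure_integrable_cst.
  pose h' : L2 P := mkL2 mh h2; pose o' : L2 P := mkL2 (measurable_cst (1 : R)) o2.
  have := cauchy_schwarz (semi_inner_L2 P) h' o'.
  have -> : bP o' o' = 1.
    rewrite -[RHS](Rintegral_probability_cst P); apply: eq_Rintegral => w _.
    by rewrite -[LHS]/(1 * 1 : R) mulr1.
  have -> : bP h' o' = phi y - phi z.
    rewrite /phi -RintegralB//; apply: eq_Rintegral => w _.
    by rewrite -[LHS]/(h w * 1) mulr1.
  move=> /le_trans; apply; rewrite mulr1 -noise_distance L2_inner_sqr [leRHS]L2_inner_sqr.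
  by apply: le_Rintegral => //; exact: L2_sqr_integrable.
have near_x n : exists s, b (j s - x) (j s - x) <= harmonic n.
  have hn0 : 0 < harmonic n :> R by rewrite /harmonic invr_gt0.
  have bx : (ball x (harmonic n)) !=set0 by exists x; exact: ballxx.
  have [y [xy [s _ sy]]] := completion_dense H_completion bx (ball_open x _).
  exists s; rewrite /b -(completion_norm H_completion) sy distrC.
  move: xy; rewrite -ball_normE /ball_/= => /ltW xy.
  (* The distance is at most 1/(n+1) <= 1, so its square is also at most 1/(n+1). *)
  rewrite expr2 (le_trans (ler_pM _ _ xy xy))// -[leRHS]mulr1 ler_wpM2l ?(ltW hn0)//.
  by rewrite /harmonic invf_le1// ler1n.
have [s sP] := choice near_x.
have s0 : b (j (s n) - x) (j (s n) - x) @[n --> \oo] --> 0.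
  by apply: (squeeze0 _ cvg_harmonic) => n; rewrite sP (inner_ge0 semi_inner_dot).
have c1 : phi (j (s n)) @[n --> \oo] --> phi x.
  exact: (cvg_sqr_le (fun n => phi_lip (j (s n)) x) s0).
have c2 : phi (j (s n)) @[n --> \oo] --> cos a * expR (- (2^-1 * b x x)).
  have -> : (fun n => phi (j (s n))) = fun n => cos a * expR (- (2^-1 * b (j (s n)) (j (s n)))).
    by apply/funext => n; exact: noise_cos_j.
  apply: cvgMl_tmp; apply: (cvg_comp _ expR); last exact: continuous_expR.
  by apply: cvgN; apply: cvgMl_tmp; exact: (inner_cvg2 semi_inner_dot s0 s0).
by rewrite -[LHS]/(phi x) -(cvg_lim _ c1)// (cvg_lim _ c2).
Qed.

Section NoiseVariable.
Variables (Y : L2 P) (x : H).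
Hypothesis YQ : Y = Q x %[ae P].

Lemma noise_variable_cos t a :
  \int[P]_w cos (t * Y w + a) = cos a * expR (- (t ^+ 2 * `|x| ^+ 2 / 2)).
Proof.
transitivity (\int[P]_w cos (Q (t *: x) w + a)).
  apply: ae_eq_Rintegral.
  - exact: measurableT_comp (measurable_cosL t a) (L2_measurable Y).
  - by apply: measurable_cosX; exact: L2_measurable.
  - apply: filterS2 YQ (noiseZ t x) => w h1 h2 _; rewrite h1// h2//.
rewrite noise_cos (innerZl semi_inner_dot) (innerZr semi_inner_dot).
rewrite /b -(completion_norm H_completion); congr (_ * expR (- _)); by field.
Qed.

Lemma noise_variable_gaussian : gaussian_variable P Y.
Proof.
split; first exact: L2_measurable.
exists 0, `|x|; apply: gaussian_law_characteristic => //.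
exact: noise_variable_cos.
Qed.

Let iY : P.-integrable setT (EFin \o Y).
Proof. exact/Lfun1_integrable/L2_Lfun1. Qed.

(* The law of Y is symmetric, hence so are its truncations. *)
Lemma noise_variable_mean : \int[P]_w Y w = 0.
Proof.
pose g (n : nat) (y : R) := y * \1_(`[- n%:R, n%:R]%classic) y.
have g_le n y : `|g n y| <= n%:R.
  rewrite /g indicE; case: (boolP (y \in _)) => [/set_mem|_]; last by rewrite mulr0 normr0.
  by rewrite /= in_itv/= mulr1 ler_norml.
have gY n y : `|g n y| <= `|y|.
  by rewrite normrM indicE ler_piMr// normr_nat lern1 leq_b1.
have mg n : measurable_fun setT (g n).
  by apply: measurable_funM => //; exact: measurable_indic.
have gN n y : g n (- y) = - g n y.
  rewrite /g mulNr; congr (- (_ * _)); rewrite !indicE; congr ((nat_of_bool _)%:R).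
  by apply/idP/idP => /set_mem/=; rewrite in_itv/= => /andP[h1 h2]; apply/mem_set; rewrite /= in_itv/=; lra.
have mY := L2_measurable Y.
have mgY n : measurable_fun setT (fun w => g n (Y w)) by exact: measurableT_comp (mg n) mY.
have g0 n : \int[P]_w g n (Y w) = 0.
  have i1 : P.-integrable setT (EFin \o (fun=> 1 : R)).
    exact: finite_measure_integrable_cst.
  have mNY : measurable_fun setT (fun w => - Y w) by exact: measurableT_comp.
  have cosY t a : \int[P]_w (cos (t * Y w + a) * 1) = \int[P]_w (cos (t * - Y w + a) * 1).
    under eq_Rintegral do rewrite mulr1.
    under [RHS]eq_Rintegral do rewrite mulr1 mulrN -mulNr.
    by rewrite !noise_variable_cos sqrrN.
  have := law_unique mY mNY (fun=> ler01) (fun=> ler01) i1 i1 cosY (mg n) (g_le n).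
  have -> : \int[P]_w (g n (Y w) * 1) = \int[P]_w g n (Y w).
    by apply: eq_Rintegral => w _; rewrite mulr1.
  have -> : \int[P]_w (g n (- Y w) * 1) = -1 * \int[P]_w g n (Y w).
    rewrite -RintegralZl//; last exact: bounded_integrable (mgY n) (fun w => g_le n (Y w)).
    by apply: eq_Rintegral => w _; rewrite mulr1 gN mulN1r.
  lra.
have c1 : \int[P]_w g n (Y w) @[n --> \oo] --> \int[P]_w Y w.
  apply: (@Rdominated_cvg _ _ _ P _ _ (fun w => `|Y w|)) => //.
  - move=> w; apply: (cvg_near_cst _ _ (F := \oo)); near=> n.
    rewrite /g indicE mem_set ?mulr1//= in_itv/= -ler_norml.
    by near: n; exact: nbhs_infty_ger.
  - exact: integrable_norm iY.
rewrite -(cvg_lim _ c1)//.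
by under eq_fun do rewrite g0; rewrite lim_cst.
Unshelve. all: by end_near. Qed.

End NoiseVariable.

Section NoiseSeries.
Variable e : nat -> H.
Hypothesis he : forall i k, ip (e i) (e k) = (i == k)%:R.
Variable c : nat -> R.

(** Stated for lists of distinct indices because the Cauchy criterion concerns blocks of consecutive
    terms, not initial segments. *)
Lemma inner_orthonormal_uniq (s : seq nat) : uniq s ->
  b (\sum_(k <- s) c k *: e k) (\sum_(k <- s) c k *: e k) = \sum_(k <- s) c k ^+ 2.
Proof.
have hb := semi_inner_dot.
elim: s => [|k s IH] /=; first by rewrite !big_nil (inner0l hb).
move=> /andP[ks us]; rewrite !big_cons (inner_sqD hb) IH//.
rewrite (innerZl hb) (innerZr hb) (innerZl hb) /b he eqxx mulr1 -/(b _ _).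
have -> : b (e k) (\sum_(i <- s) c i *: e i) = 0.
  rewrite (innerC hb); elim: s ks {IH us} => [|i s IH]; first by rewrite big_nil (inner0l hb).
  rewrite inE negb_or => /andP[ki ks]; rewrite big_cons (innerDl hb) (innerZl hb) IH// addr0.
  by rewrite /b he eq_sym (negbTE ki) mulr0.
by rewrite !mulr0 addr0 expr2.
Qed.

Hypothesis c_bounded : exists B, forall n, \sum_(i < n) c i ^+ 2 <= B.

(** By Pythagoras the squared norm of a block is the corresponding block of the series of squares,
    which converges; the completeness of H does the rest. *)
Lemma orthonormal_series_cvg : exists x,
  b (\sum_(i < n) c i *: e i - x) (\sum_(i < n) c i *: e i - x) @[n --> \oo] --> 0.
Proof.
have [B cB] := c_bounded.
have c2 : cvgn (series (fun i => c i ^+ 2)).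
  apply: nondecreasing_is_cvgn; first by apply: nondecreasing_series => i _ _; exact: sqr_ge0.
  by exists B => _ [n _ <-]; rewrite /series/= big_mkord.
have : cauchy (series (fun i => c i *: e i) @ \oo).
  apply/cauchy_seriesP => eps eps0.
  have /cvg_cauchy/cauchy_seriesP/(_ _ (exprn_gt0 2 eps0)) := c2.
  apply: filterS => -[m n] /=; rewrite ger0_norm ?sumr_ge0// => [h|i _]; last exact: sqr_ge0.
  rewrite -(ltr_pXn2r (ltn0Sn 1)) ?nnegrE ?(ltW eps0)//.
  by rewrite (completion_norm H_completion) -/(b _ _) inner_orthonormal_uniq// iota_uniq.
move=> /cauchy_cvg/cvg_ex[x sx]; exists x.
have n0 : `|series (fun i => c i *: e i) n - x| @[n --> \oo] --> 0.
  by rewrite -[0](@normr0 _ H); apply: cvg_norm; apply/subr_cvg0.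
by apply: eq_seq_cvg (cvg_sqr0 n0) => n; rewrite (completion_norm H_completion) /series/= big_mkord.
Qed.

Lemma L2_sumE0 (Z : nat -> L2 P) (X : L2 P) N :
  ('N[P]_2%:E[EFin \o (fun w => (\sum_(0 <= n < N) c n * Z n w - X w)%R)] =
   (Num.sqrt (bP (\sum_(i < N) c i *: Z i - X) (\sum_(i < N) c i *: Z i - X)))%:E)%E.
Proof.
rewrite -Lnorm2E; congr Lnorm; apply/funext => w /=; congr EFin.
by rewrite big_mkord -[RHS]/((\sum_(i < N) c i *: Z i) w - X w) L2_sumE.
Qed.

Lemma L2_sumP (Z : nat -> L2 P) (X : L2 P) : L2_sum c Z X <->
  bP (\sum_(i < N) c i *: Z i - X) (\sum_(i < N) c i *: Z i - X) @[N --> \oo] --> 0.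
Proof.
have b0 N := inner_ge0 (semi_inner_L2 P) (\sum_(i < N) c i *: Z i - X).
rewrite /L2_sum (funext (L2_sumE0 Z X)); split => [/fine_cvg /= h|h].
  by apply: eq_seq_cvg (cvg_sqr0 h) => N /=; rewrite (sqr_sqrtr (b0 N)).
apply: cvg_EFin; first exact: nearW.
apply: (cvg_sqr_le (v := fun N => bP (\sum_(i < N) c i *: Z i - X) (\sum_(i < N) c i *: Z i - X))) => // N.
by rewrite subr0 /= (sqr_sqrtr (b0 N)).
Qed.

(** Represents every L^2 sum of the series by a vector of H, so that later computations can take
    place in H. *)
Lemma noise_series : exists x, [/\
  b (\sum_(i < n) c i *: e i - x) (\sum_(i < n) c i *: e i - x) @[n --> \oo] --> 0,
  L2_sum c (fun n => Q (e n)) (Q x) &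
  forall X, L2_sum c (fun n => Q (e n)) X -> X = Q x %[ae P]].
Proof.
have [x sx] := orthonormal_series_cvg.
have hP := semi_inner_L2 P.
have sQ : bP (\sum_(i < N) c i *: Q (e i) - Q x) (\sum_(i < N) c i *: Q (e i) - Q x) @[N --> \oo] --> 0.
  apply: eq_seq_cvg sx => N.
  rewrite -noise_distance.
  set S := \sum_(i < N) c i *: e i.
  have h : Q S - Q x = \sum_(i < N) c i *: Q (e i) - Q x %[ae P].
    by apply: filterS (noise_sum N c e) => w h _; rewrite -[LHS]/(Q S w - Q x w) h.
  exact: (ae_eq_L2_inner h h).
exists x; split => //; first exact/L2_sumP.
move=> X /L2_sumP sX.
suff /L2_inner_eq0 : bP (X - Q x) (X - Q x) = 0.
  by apply: filterS => w h _; apply/eqP; rewrite -subr_eq0; apply/eqP; exact: h.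
have c0 : 2 * bP (\sum_(i < N) c i *: Q (e i) - X) (\sum_(i < N) c i *: Q (e i) - X) +
  2 * bP (\sum_(i < N) c i *: Q (e i) - Q x) (\sum_(i < N) c i *: Q (e i) - Q x) @[N --> \oo] -->
  (2 * 0 + 2 * 0 : R) by apply: cvgD; exact: cvgMl_tmp.
rewrite mulr0 addr0 in c0.
(* A constant sequence: the squared distance between two L^2 limits is at most twice the sum of the
   squared errors of the partial sums. *)
have cc : bP (X - Q x) (X - Q x) @[_ --> \oo] --> (0 : R).
  apply: (squeeze0 _ c0) => N; rewrite (inner_ge0 hP)/=.
  set S := \sum_(i < N) _.
  have -> : X - Q x = (S - Q x) - (S - X) by rewrite opprB [RHS]addrC subrKA.
  have := inner_ge0 hP ((S - Q x) + (S - X)).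
  by rewrite (inner_sqD hP (S - Q x) (S - X)) (inner_sqB hP (S - Q x) (S - X)); lra.
by rewrite -(cvg_lim _ cc)// lim_cst.
Qed.

End NoiseSeries.

End Noise.

(** * One real component of the process *)

Section NoiseComponent.
Context (R : realType).
Variables (sigma : {measure set (measurableTypeR R) -> \bar R}).
Variables (H : completeNormedModType R) (ip : {dot H for idfun}).
Variables (j : {linear schwartz R -> H}) (H_completion : is_completion sigma ip j).
Variables (P : probability (tempered_space R) R) (P_noise : is_white_noise sigma P).
Variables (Q : H -> L2 P) (Q_iso : is_noise_isometry j Q).
Variables (g : nat -> H) (hg : forall i k, ip (g i) (g k) = (i == k)%:R).
Variables (C S : R -> nat -> R).
Hypothesis C_bounded : forall t, exists B, forall n, \sum_(i < n) C t i ^+ 2 <= B.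
Hypothesis S_bounded : forall t, exists B, forall n, \sum_(i < n) S t i ^+ 2 <= B.

Notation Zeven := (fun n => Q (g (2 * n)%N)).
Notation Zodd := (fun n => Q (g (2 * n + 1)%N)).

Let hb := semi_inner_dot H_completion.

Let he i k : ip (g (2 * i)%N) (g (2 * k)%N) = (i == k)%:R.
Proof. by rewrite hg eqn_mul2l. Qed.

Let ho i k : ip (g (2 * i + 1)%N) (g (2 * k + 1)%N) = (i == k)%:R.
Proof. by rewrite hg eqn_add2r eqn_mul2l. Qed.

Let heo i k : ip (g (2 * i)%N) (g (2 * k + 1)%N) = 0.
Proof. by rewrite hg; case: eqP => // h; exfalso; lia. Qed.

Let se t := noise_series H_completion Q_iso he (C_bounded t).
Let so t := noise_series H_completion Q_iso ho (S_bounded t).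

Lemma noise_component_series t :
  (exists X, L2_sum (C t) Zeven X) /\ (exists X, L2_sum (S t) Zodd X).
Proof.
by split; [have [x [_ h _]] := se t|have [x [_ h _]] := so t]; exists (Q x).
Qed.

Variables B B' : R -> L2 P.
Hypothesis BC : forall t, L2_sum (C t) Zeven (B t).
Hypothesis BS : forall t, L2_sum (S t) Zodd (B' t).

Let noise_element t : exists xy : H * H, [/\
  ip (\sum_(i < n) C t i *: g (2 * i)%N - xy.1) (\sum_(i < n) C t i *: g (2 * i)%N - xy.1) @[n --> \oo] --> (0 : R),
  ip (\sum_(i < n) S t i *: g (2 * i + 1)%N - xy.2) (\sum_(i < n) S t i *: g (2 * i + 1)%N - xy.2) @[n --> \oo] --> (0 : R) &
  B t + B' t = Q (xy.1 + xy.2) %[ae P]].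
Proof.
have [x [xs _ xu]] := se t; have [y [ys _ yu]] := so t; exists (x, y); split => //=.
apply: ae_eq_trans (ae_eq_sym (noiseD Q_iso x y)).
have hx := xu _ (BC t); have hy := yu _ (BS t).
by apply: filterS2 hx hy => w h1 h2 _; rewrite -[LHS]/(B t w + B' t w) h1// h2.
Qed.

(** A linear combination of values of the process is almost surely Q of the same combination of
    vectors, hence Gaussian by the one-variable result. *)
Lemma noise_component_gaussian :
  centered_gaussian_process P (fun t w => B t w + B' t w).
Proof.
have /choice[xy xyP] := noise_element.
pose x t := (xy t).1 + (xy t).2.
have xB t : B t + B' t = Q (x t) %[ae P] by have [] := xyP t.
split => [n t c|t].
  have YQ : \sum_(i < n) c i *: (B (t i) + B' (t i)) = Q (\sum_(i < n) c i *: x (t i)) %[ae P].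
    elim: n t c => [|n IH] t c; first by rewrite !big_ord0; apply: ae_eq_sym; exact: (noise0 Q_iso).
    rewrite !big_ord_recr/= [X in Q X]addrC.
    have h := noise_lin Q_iso (c ord_max) (x (t ord_max))
      (\sum_(i < n) c (widen_ord (leqnSn n) i) *: x (t (widen_ord (leqnSn n) i))).
    have IHn := IH (fun i => t (widen_ord (leqnSn n) i)) (fun i => c (widen_ord (leqnSn n) i)).
    apply: filterS3 h IHn (xB (t ord_max)) => w h1 h2 h3 _; rewrite h1//.
    rewrite addrC -[LHS]/(c ord_max * (B (t ord_max) + B' (t ord_max)) w + (_ : L2 P) w).
    by rewrite h2// h3.
  have := noise_variable_gaussian H_completion P_noise Q_iso YQ.
  by congr gaussian_variable; apply/funext => w; rewrite L2_sumE.
have := noise_variable_mean H_completion P_noise Q_iso (xB t).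
have fin := expectation_fin_num (L2_Lfun1 (B t + B' t)).
move=> h; rewrite -[LHS](fineK fin); congr EFin.
by rewrite unlock.
Qed.

(** The isometry moves the expectation to H. There the even and the odd parts contribute the two
    sums of products of coefficients, and the mixed terms vanish as limits of inner products of
    orthogonal partial sums. *)
Lemma noise_component_covariance s t (K1 K2 : R) :
  \sum_(0 <= n < N) C s n * C t n @[N --> \oo] --> K1 ->
  \sum_(0 <= n < N) S s n * S t n @[N --> \oo] --> K2 ->
  \int[P]_w ((B s w + B' s w) * (B t w + B' t w)) = K1 + K2.
Proof.
move=> hC hS.
have [[x1 y1] [cx1 cy1 e1]] := noise_element s.
have [[x2 y2] [cx2 cy2 e2]] := noise_element t.
rewrite -[LHS]/(L2_inner (B s + B' s) (B t + B' t)).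
rewrite (ae_eq_L2_inner e1 e2) (noise_inner H_completion Q_iso) -[LHS]/(ip (x1 + y1) (x2 + y2)).
rewrite (innerDl hb) !(innerDr hb).
have -> : ip x1 x2 = K1.
  have c := inner_cvg2 hb cx1 cx2.
  rewrite -(cvg_lim _ c)// -(cvg_lim _ hC)//; congr (lim (_ @ \oo)); apply/funext => N.
  by rewrite (inner_orthonormal_sums hb he) big_mkord.
have -> : ip y1 y2 = K2.
  have c := inner_cvg2 hb cy1 cy2.
  rewrite -(cvg_lim _ c)// -(cvg_lim _ hS)//; congr (lim (_ @ \oo)); apply/funext => N.
  by rewrite (inner_orthonormal_sums hb ho) big_mkord.
have cross u v t1 t2 :
  ip (\sum_(i < n) C t1 i *: g (2 * i)%N - u) (\sum_(i < n) C t1 i *: g (2 * i)%N - u) @[n --> \oo] --> (0 : R) ->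
  ip (\sum_(i < n) S t2 i *: g (2 * i + 1)%N - v) (\sum_(i < n) S t2 i *: g (2 * i + 1)%N - v) @[n --> \oo] --> (0 : R) ->
  ip u v = 0.
  move=> cu cv; have c := inner_cvg2 hb cu cv.
  rewrite -(cvg_lim _ c)//; under eq_fun => N.
    rewrite (inner_suml hb) big1 ?lim_cst//; last first.
      move=> i _; rewrite (innerC hb) (inner_suml hb) big1// => k _.
      by rewrite (innerZl hb) (innerZr hb) (innerC hb) heo !mulr0.
    over.
  by rewrite lim_cst.
rewrite (cross _ _ _ _ cx1 cy2) (innerC hb y1 x2) (cross _ _ _ _ cx2 cy1); ring.
Qed.

End NoiseComponent.

(** * The covariance kernel *)

Section KernelFunctions.
Context (R : realType) (m : R -> R).
Hypothesis m_meas : measurable_fun setT m.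
Hypothesis m_ge0 : forall u, 0 <= m u.
Hypothesis m_int : (\int[lebesgue_measure]_u (m u / (u ^+ 2 + 1))%:E < +oo)%E.
Notation leb := (@lebesgue_measure R).

(** The function whose Hermite coefficients appear in the series, phi being 1 - cos tu or sin tu; at
    u = 0 its value is 0, by the convention on division. *)
Definition weighted (phi : R -> R) (u : R) : R := phi u / u * Num.sqrt (m u).

Let inv_meas : measurable_fun setT (fun u : R => u^-1).
Proof.
have mF : measurable_fun (setT : set (measurableTypeR R)) (fun u : R => u^-1).
  have o : open (~` [set (0 : R)]).
    by apply: closed_openC; apply: accessible_closed_set1; apply: hausdorff_accessible; exact: norm_hausdorff.
  rewrite -(setvU [set (0 : R)]); apply/measurable_funU; [exact: open_measurable|exact: measurable_set1|split].
    apply: open_continuous_measurable_fun => // u; rewrite inE/= => u0.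
    by apply: inv_continuous; apply/eqP.
  exact: measurable_fun_set1.
exact: mF.
Qed.

Lemma measurable_weighted (phi : R -> R) : measurable_fun setT phi -> measurable_fun setT (weighted phi).
Proof.
move=> mphi; apply: measurable_funM; first exact: measurable_funM.
apply: (measurableT_comp (f := @Num.sqrt R)) => //.
by apply: continuous_measurable_fun; exact: sqrt_continuous.
Qed.

Let inv2_meas : measurable_fun setT (fun u : R => (u ^+ 2 + 1)^-1).
Proof.
apply: (measurableT_comp inv_meas).
by apply: measurable_funD => //; exact: measurable_funX.
Qed.

Let m_integrable : leb.-integrable setT (EFin \o (fun u => m u / (u ^+ 2 + 1))).
Proof.
apply/integrableP; split; first by apply/measurable_EFinP; exact: measurable_funM.
apply: le_lt_trans m_int; rewrite le_eqVlt; apply/orP; left; apply/eqP.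
apply: eq_integral => u _; rewrite gee0_abs// lee_fin mulr_ge0// invr_ge0.
by rewrite addr_ge0// sqr_ge0.
Qed.

(** (phi/u)^2 (u^2 + 1) = phi^2 + (phi/u)^2 <= 4 + t^2: the bound by 2 acts at infinity, the bound
    by |t u| near 0, and m(u)/(u^2 + 1) remains as majorant. *)
Lemma weighted_sqr_integrable (phi : R -> R) (t : R) : measurable_fun setT phi ->
  (forall u, `|phi u| <= 2) -> (forall u, `|phi u| <= `|t * u|) ->
  leb.-integrable setT (EFin \o (fun u => weighted phi u ^+ 2)).
Proof.
move=> mphi phi2 phit.
apply: (@le_integrable _ _ _ leb _ measurableT _
  (fun u => ((4 + t ^+ 2)%:E * (m u / (u ^+ 2 + 1))%:E)%E)); last first.
- exact: integrableZl.
- move=> u _; rewrite -EFinM /= lee_fin; apply: le_trans (ler_norm _).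
  rewrite ger0_norm ?sqr_ge0// /weighted exprMn sqr_sqrtr//.
  have u1 : 0 < u ^+ 2 + 1 by rewrite ltr_wpDl// sqr_ge0.
  rewrite mulrCA mulrC ler_wpM2l// ler_pdivlMr//.
  have [->|u0] := eqVneq u 0.
    by rewrite invr0 mulr0 expr0n mul0r addr_ge0// sqr_ge0.
  have -> : (phi u / u) ^+ 2 * (u ^+ 2 + 1) = phi u ^+ 2 + (phi u / u) ^+ 2 by field.
  apply: lerD.
    by have := phi2 u; rewrite ler_norml => /andP[]; nra.
  rewrite -(real_normK (num_real (phi u / u))) -(real_normK (num_real t)).
  by rewrite ler_pXn2r ?nnegrE// normf_div ler_pdivrMr ?normr_gt0// -normrM.
by apply/measurable_EFinP; apply: measurable_funX; exact: measurable_weighted.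
Qed.

Definition onem_cos (t u : R) : R := 1 - cos (t * u).
Definition sin_mul (t u : R) : R := sin (t * u).

Lemma measurable_onem_cos t : measurable_fun setT (onem_cos t).
Proof.
apply: measurable_funB => //; have := measurable_cosL t 0.
by congr measurable_fun; apply/funext => u; rewrite addr0.
Qed.

Lemma measurable_sin_mul t : measurable_fun setT (sin_mul t).
Proof.
have := measurable_sinL t 0.
by congr measurable_fun; apply/funext => u; rewrite addr0.
Qed.

Lemma onem_cos_integrable t : leb.-integrable setT (EFin \o (fun u => weighted (onem_cos t) u ^+ 2)).
Proof.
apply: (@weighted_sqr_integrable _ t (measurable_onem_cos t)) => u.
  by rewrite ger0_norm ?subr_ge0 ?cos_le1//; have := cos_geN1 (t * u); rewrite /onem_cos; lra.
exact: norm_onem_cos_le.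
Qed.

Lemma sin_mul_integrable t : leb.-integrable setT (EFin \o (fun u => weighted (sin_mul t) u ^+ 2)).
Proof.
apply: (@weighted_sqr_integrable _ t (measurable_sin_mul t)) => u.
  by rewrite (le_trans (sin_max _))// ler1n.
exact: norm_sin_le.
Qed.

Lemma cos_coefE t n :
  cos_coef m t n = \int[leb]_u (weighted (onem_cos t) u * hermite_function n u).
Proof. by apply: eq_Rintegral => u _; rewrite mulrAC. Qed.

Lemma sin_coefE t n :
  sin_coef m t n = \int[leb]_u (weighted (sin_mul t) u * hermite_function n u).
Proof. by apply: eq_Rintegral => u _; rewrite mulrAC. Qed.

Lemma cos_coef_bounded t : exists B, forall n, \sum_(i < n) cos_coef m t i ^+ 2 <= B.
Proof.
eexists => n; under eq_bigr do rewrite cos_coefE.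
exact: (hermite_bessel n (measurable_weighted (measurable_onem_cos t)) (onem_cos_integrable t)).
Qed.

Lemma sin_coef_bounded t : exists B, forall n, \sum_(i < n) sin_coef m t i ^+ 2 <= B.
Proof.
eexists => n; under eq_bigr do rewrite sin_coefE.
exact: (hermite_bessel n (measurable_weighted (measurable_sin_mul t)) (sin_mul_integrable t)).
Qed.

Lemma cos_coef_parseval s t :
  \sum_(0 <= n < N) cos_coef m s n * cos_coef m t n @[N --> \oo] -->
  \int[leb]_u (weighted (onem_cos s) u * weighted (onem_cos t) u).
Proof.
have := hermite_parseval (measurable_weighted (measurable_onem_cos s))
  (measurable_weighted (measurable_onem_cos t)) (onem_cos_integrable s) (onem_cos_integrable t).
by apply: eq_seq_cvg => N; apply: eq_bigr => i _; rewrite !cos_coefE.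
Qed.

Lemma sin_coef_parseval s t :
  \sum_(0 <= n < N) sin_coef m s n * sin_coef m t n @[N --> \oo] -->
  \int[leb]_u (weighted (sin_mul s) u * weighted (sin_mul t) u).
Proof.
have := hermite_parseval (measurable_weighted (measurable_sin_mul s))
  (measurable_weighted (measurable_sin_mul t)) (sin_mul_integrable s) (sin_mul_integrable t).
by apply: eq_seq_cvg => N; apply: eq_bigr => i _; rewrite !sin_coefE.
Qed.

Let L2_of (phi : R -> R) (mphi : measurable_fun setT phi)
    (iphi : leb.-integrable setT (EFin \o (fun u => weighted phi u ^+ 2))) :
    LfunType leb (lee1n 2) :=
  mkL2 (measurable_weighted mphi : measurable_fun (setT : set (measurableTypeR R)) (weighted phi)) iphi.

(** Each product is integrable as a product of two L^2 functions, which permits merging the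
    integrals; the square of [Num.sqrt (m u)] restores m. *)
Lemma kernel_split s t :
  \int[leb]_u (weighted (onem_cos s) u * weighted (onem_cos t) u) +
  \int[leb]_u (weighted (sin_mul s) u * weighted (sin_mul t) u) =
  \int[leb]_u (m u / u ^+ 2 * ((1 - cos (s * u)) * (1 - cos (t * u)) +
    sin (s * u) * sin (t * u))).
Proof.
rewrite -RintegralD//.
- apply: eq_Rintegral => u _; rewrite /weighted /onem_cos /sin_mul.
  have sm : m u = Num.sqrt (m u) * Num.sqrt (m u) by rewrite -expr2 sqr_sqrtr.
  by rewrite [in RHS]sm expr2 invfM; ring.
- exact: (L2M_integrable (L2_of (measurable_onem_cos s) (onem_cos_integrable s))
    (L2_of (measurable_onem_cos t) (onem_cos_integrable t))).
- exact: (L2M_integrable (L2_of (measurable_sin_mul s) (sin_mul_integrable s))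
    (L2_of (measurable_sin_mul t) (sin_mul_integrable t))).
Qed.

End KernelFunctions.

(** * Idempotent components of hyperbolic numbers *)

Section HyperbolicLam.
Context (R : realType).
Implicit Types p q : hyperbolic R.

Lemma lam1D p q : lam1 (p + q) = lam1 p + lam1 q.
Proof. by rewrite /lam1 /=; ring. Qed.
Lemma lam2D p q : lam2 (p + q) = lam2 p + lam2 q.
Proof. by rewrite /lam2 /=; ring. Qed.
Lemma lam1B p q : lam1 (p - q) = lam1 p - lam1 q.
Proof. by rewrite /lam1 /=; ring. Qed.
Lemma lam2B p q : lam2 (p - q) = lam2 p - lam2 q.
Proof. by rewrite /lam2 /=; ring. Qed.
Lemma lam1M p q : lam1 (p * q) = lam1 p * lam1 q.
Proof. by rewrite /lam1 /=; ring. Qed.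
Lemma lam2M p q : lam2 (p * q) = lam2 p * lam2 q.
Proof. by rewrite /lam2 /=; ring. Qed.
Lemma lam1Z a p : lam1 (a *: p) = a * lam1 p.
Proof. by rewrite /lam1 /=; ring. Qed.
Lemma lam2Z a p : lam2 (a *: p) = a * lam2 p.
Proof. by rewrite /lam2 /=; ring. Qed.
Lemma lam1_1 : lam1 (1 : hyperbolic R) = 1.
Proof. by rewrite /lam1 /= addr0. Qed.
Lemma lam2_1 : lam2 (1 : hyperbolic R) = 1.
Proof. by rewrite /lam2 /= subr0. Qed.
Lemma lam1_idempotents (a b : R) : lam1 (a *: ep R + b *: em R) = a.
Proof. by have [] := hyp_decomp_uniq (erefl (a *: ep R + b *: em R)). Qed.
Lemma lam2_idempotents (a b : R) : lam2 (a *: ep R + b *: em R) = b.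
Proof. by have [] := hyp_decomp_uniq (erefl (a *: ep R + b *: em R)). Qed.

End HyperbolicLam.

Lemma lam1_hyp_ext (R : realType) (f : R -> R) (p : hyperbolic R) : lam1 (hyp_ext f p) = f (lam1 p).
Proof. exact: lam1_idempotents. Qed.

Lemma lam2_hyp_ext (R : realType) (f : R -> R) (p : hyperbolic R) : lam2 (hyp_ext f p) = f (lam2 p).
Proof. exact: lam2_idempotents. Qed.

Lemma hyp_kernelE (R : realType) (m : R -> R) (p q : hyperbolic R) :
  let k (s t : R) := \int[@lebesgue_measure R]_u (m u / u ^+ 2 *
    ((1 - cos (s * u)) * (1 - cos (t * u)) + sin (s * u) * sin (t * u))) in
  hyp_kernel m p q = k (lam1 p) (lam1 q) *: ep R + k (lam2 p) (lam2 q) *: em R.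
Proof.
move=> k; congr (_ *: _ + _ *: _); apply: eq_Rintegral => u _.
  rewrite lam1Z lam1D !lam1M !lam1B lam1_1 !lam1_hyp_ext !lam1Z.
  by rewrite (mulrC u) (mulrC u).
rewrite lam2Z lam2D !lam2M !lam2B lam2_1 !lam2_hyp_ext !lam2Z.
by rewrite (mulrC u) (mulrC u).
Qed.

Lemma hyp_covarianceE (R : realType) d (T : measurableType d) (P1 P2 : probability T R)
    (B1 B3 : R -> L2 P1) (B2 B4 : R -> L2 P2) p q :
  hyp_covariance P1 P2 (hyp_process B1 B3 B2 B4) p q =
  (\int[P1]_w ((B1 (lam1 p) w + B3 (lam1 p) w) * (B1 (lam1 q) w + B3 (lam1 q) w))) *: ep R +
  (\int[P2]_w ((B2 (lam2 p) w + B4 (lam2 p) w) * (B2 (lam2 q) w + B4 (lam2 q) w))) *: em R.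
Proof.
rewrite /hyp_covariance /hyp_expectation unlock.
congr (_ *: _ + _ *: _); apply: eq_Rintegral => w _.
  by rewrite lam1M !lam1_idempotents.
by rewrite lam2M !lam2_idempotents.
Qed.

(** Passes from the real time of a component to hyperbolic time through [lam1] or [lam2]; coinciding
    times are harmless, since [gaussian_process] admits families with repetitions. *)
Lemma centered_gaussian_process_comp (R : realType) d (T : measurableType d)
    (P : probability T R) (I J : Type) (f : J -> I) (X : I -> T -> R) :
  centered_gaussian_process P X -> centered_gaussian_process P (fun j => X (f j)).
Proof. by move=> [gX cX]; split => [n t c|j]; [exact: (gX n (f \o t))|exact: cX]. Qed.

Theorem theorem9p1 (R : realType)
  (m : R -> R) (m_meas : measurable_fun setT m) (m_ge0 : forall u, 0 <= m u)
  (m_even : forall u, m (- u) = m u)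
  (m_int : (\int[lebesgue_measure]_u (m u / (u ^+ 2 + 1))%:E < +oo)%E)
  (sigma mu : {measure set (measurableTypeR R) -> \bar R})
  (sigma_int : tempered_measure sigma) (mu_int : tempered_measure mu)
  (Hs : completeNormedModType R) (ips : {dot Hs for idfun})
  (js : {linear schwartz R -> Hs}) (Hs_completion : is_completion sigma ips js)
  (Hm : completeNormedModType R) (ipm : {dot Hm for idfun})
  (jm : {linear schwartz R -> Hm}) (Hm_completion : is_completion mu ipm jm)
  (Hs_sep : separable Hs) (Hs_inf : infinite_dimensional Hs)
  (Hm_sep : separable Hm) (Hm_inf : infinite_dimensional Hm)
  (g : nat -> Hs) (g_basis : orthonormal_basis ips g)
  (h : nat -> Hm) (h_basis : orthonormal_basis ipm h)
  (P1 P2 : probability (tempered_space R) R)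
  (P1_noise : is_white_noise sigma P1) (P2_noise : is_white_noise mu P2)
  (Qs : Hs -> L2 P1) (Qs_iso : is_noise_isometry js Qs)
  (Qm : Hm -> L2 P2) (Qm_iso : is_noise_isometry jm Qm) :
  let Z n := Qs (g n) in
  let W n := Qm (h n) in
  (forall t : R,
    [/\ exists X, L2_sum (cos_coef m t) (fun n => Z (2 * n)%N) X,
        exists X, L2_sum (sin_coef m t) (fun n => Z (2 * n + 1)%N) X,
        exists X, L2_sum (cos_coef m t) (fun n => W (2 * n)%N) X &
        exists X, L2_sum (sin_coef m t) (fun n => W (2 * n + 1)%N) X]) /\
  (forall (B1 B3 : R -> L2 P1) (B2 B4 : R -> L2 P2),
    (forall t, L2_sum (cos_coef m t) (fun n => Z (2 * n)%N) (B1 t)) ->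
    (forall t, L2_sum (cos_coef m t) (fun n => W (2 * n)%N) (B2 t)) ->
    (forall t, L2_sum (sin_coef m t) (fun n => Z (2 * n + 1)%N) (B3 t)) ->
    (forall t, L2_sum (sin_coef m t) (fun n => W (2 * n + 1)%N) (B4 t)) ->
    hyp_centered_gaussian P1 P2 (hyp_process B1 B3 B2 B4) /\
    forall p q : hyperbolic R,
      hyp_covariance P1 P2 (hyp_process B1 B3 B2 B4) p q = hyp_kernel m p q).
Proof.
move=> Z W.
have cB := cos_coef_bounded m_meas m_ge0 m_int.
have sB := sin_coef_bounded m_meas m_ge0 m_int.
split=> [t|B1 B3 B2 B4 hB1 hB2 hB3 hB4].
  have [? ?] := noise_component_series Hs_completion Qs_iso g_basis.1 cB sB t.
  by have [? ?] := noise_component_series Hm_completion Qm_iso h_basis.1 cB sB t.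
split.
  split.
    have := centered_gaussian_process_comp (@lam1 R)
      (noise_component_gaussian Hs_completion P1_noise Qs_iso g_basis.1 cB sB hB1 hB3).
    congr centered_gaussian_process; apply/funext => p; apply/funext => w.
    exact/esym/lam1_idempotents.
  have := centered_gaussian_process_comp (@lam2 R)
    (noise_component_gaussian Hm_completion P2_noise Qm_iso h_basis.1 cB sB hB2 hB4).
  congr centered_gaussian_process; apply/funext => p; apply/funext => w.
  exact/esym/lam2_idempotents.
move=> p q; rewrite hyp_covarianceE hyp_kernelE /= -!kernel_split//.
have cP := cos_coef_parseval m_meas m_ge0 m_int.
have sP := sin_coef_parseval m_meas m_ge0 m_int.
rewrite (noise_component_covariance Hs_completion Qs_iso g_basis.1 cB sB hB1 hB3 (cP _ _) (sP _ _)).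
by rewrite (noise_component_covariance Hm_completion Qm_iso h_basis.1 cB sB hB2 hB4 (cP _ _) (sP _ _)).
Qed.
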